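(* Let $(\mathcal A,\mathcal B,\mathcal C)$ be a recollement of extriangulated categories, with functors $i^*,i_*,i^!,j_!,j^*,j_*$, where $\mathcal B$ has enough projectives and enough injectives and the functors $i^!$ and $j_!$ are exact. (1) Let $(\mathcal U_1,\mathcal V_1)$ and $(\mathcal U_3,\mathcal V_3)$ be cotilting cotorsion pairs in $\mathcal A$ and $\mathcal C$ respectively. Then the glued cotorsion pair $(\mathcal U_2,\mathcal V_2)$ in $\mathcal B$ is a cotilting cotorsion pair. (2) Let $(\mathcal U_1,\mathcal V_1)$ and $(\mathcal U_3,\mathcal V_3)$ be tilting cotorsion pairs in $\mathcal A$ and $\mathcal C$ respectively. Assume that $\mathcal A$ has finite projective global dimension. Then the glued cotorsion pair $(\mathcal U_2,\mathcal V_2)$ in $\mathcal B$ is a tilting cotorsion pair.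
   Context: Extriangulated categories $(\mathcal E,\mathbb E_{\mathcal E},\mathfrak s_{\mathcal E})$ are in the sense of Nakaoka–Palu. Standing assumptions: all extriangulated categories are $k$-linear over a field $k$, Hom-finite, Krull–Schmidt, and satisfy Condition (WIC): if a composite $gf$ is a deflation then $g$ is a deflation; if $gf$ is an inflation then $f$ is an inflation. A subcategory means a full subcategory closed under isomorphisms, finite direct sums and direct summands. $\mathcal P_{\mathcal E}$, $\mathcal I_{\mathcal E}$ denote the projective and injective objects. Exact notions. A morphism is compatible if it is an isomorphism whenever it is both an inflation and a deflation. A sequence $A\xrightarrow{f}B\xrightarrow{g}C$ is right exact if there is an $\mathbb E$-triangle $K\xrightarrow{h_2}B\xrightarrow{g}C\dashrightarrow$ and a compatible deflation $h_1:A\to K$ with $f=h_2h_1$; it is left exact if there is an $\mathbb E$-triangle $A\xrightarrow{f}B\xrightarrow{h_1}K\dashrightarrow$ and a compatible inflation $h_2:K\to C$ with $g=h_2h_1$. A sequence $A\xrightarrow{f}B\xrightarrow{g}C\xrightarrow{h}D$ is a right exact (resp. left exact) $\mathbb E$-triangle sequence if there are $\mathbb E$-triangles $A\xrightarrow{f}B\xrightarrow{g_1}K\dashrightarrow$ and $K\xrightarrow{g_2}C\xrightarrow{h}D\dashrightarrow$ with $g=g_2g_1$ and $g_1$ (resp. $g_2$) compatible. An additive functor is right (resp. left) exact if it preserves compatible morphisms and right (resp. left) exact sequences. An additive functor $F$ is exact if for every $\mathbb E$-triangle $A\xrightarrow{f}B\xrightarrow{g}C\dashrightarrow$ the sequence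 $FA\xrightarrow{Ff}FB\xrightarrow{Fg}FC$ is an $\mathbb E$-triangle. Recollement. A recollement $(\mathcal A,\mathcal B,\mathcal C)$ of extriangulated categories consists of exact functors $i_*:\mathcal A\to\mathcal B$, $j^*:\mathcal B\to\mathcal C$, right exact functors $i^*:\mathcal B\to\mathcal A$, $j_!:\mathcal C\to\mathcal B$ and left exact functors $i^!:\mathcal B\to\mathcal A$, $j_*:\mathcal C\to\mathcal B$ such that: (R1) $(i^*,i_*,i^!)$ and $(j_!,j^*,j_* )$ are adjoint triples; (R2) $\mathrm{Im}\, i_*=\mathrm{Ker}\, j^*$; (R3) $i_*,j_!,j_*$ are fully faithful; (R4) for each $X\in\mathcal B$ there is a left exact $\mathbb E_{\mathcal B}$-triangle sequence $i_*i^!X\to X\to j_*j^*X\to i_*A$ with $A\in\mathcal A$, the first two maps being the adjunction morphisms; (R5) for each $X\in\mathcal B$ there is a right exact $\mathbb E_{\mathcal B}$-triangle sequence $i_*A'\to j_!j^*X\to X\to i_*i^*X$ with $A'\in\mathcal A$, the last two maps being the adjunction morphisms. Under the hypotheses of the claim, $\mathcal A$ and $\mathcal C$ also have enough projectives and enough injectives. For $\mathcal E$ with enough projectives and injectives: $\mathbb E^{i+1}_{\mathcal E}(X,Y):=\mathbb E_{\mathcal E}(\Omega^iX,Y)$, where $\Omega X$ is any object in an $\mathbb E_{\mathcal E}$-triangle $\Omega X\to P\to X\dashrightarrow$ with $P\in\mathcal P_{\mathcal E}$. For a subcategory $\mathcal D$: $\mathcal D^{\bot}=\{X\mid\mathbb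 E^i_{\mathcal E}(\mathcal D,X)=0\ \forall i>0\}$, ${}^{\bot}\mathcal D=\{X\mid\mathbb E^i_{\mathcal E}(X,\mathcal D)=0\ \forall i>0\}$, ${}^{\bot_1}\mathcal D=\{X\mid \mathbb E_{\mathcal E}(X,\mathcal D)=0\}$. Put $\mathcal D^{\vee}_0=\mathcal D^{\wedge}_0=\mathcal D$; for $i\ge1$, $\mathcal D^{\wedge}_i$ consists of the $Y$ admitting an $\mathbb E_{\mathcal E}$-triangle $C\to D\to Y\dashrightarrow$ with $C\in\mathcal D^{\wedge}_{i-1}$, $D\in\mathcal D$, and $\mathcal D^{\vee}_i$ of the $X$ admitting $X\to D\to C\dashrightarrow$ with $D\in\mathcal D$, $C\in\mathcal D^{\vee}_{i-1}$. $\mathcal D^{\wedge}=\bigcup_i\mathcal D^{\wedge}_i$, $\mathcal D^{\vee}=\bigcup_i\mathcal D^{\vee}_i$. $\mathrm{pd}_{\mathcal E}\mathcal D\le n$ means $\mathcal D\subseteq(\mathcal P_{\mathcal E})^{\wedge}_n$; $\mathrm{id}_{\mathcal E}\mathcal D\le n$ means $\mathcal D\subseteq(\mathcal I_{\mathcal E})^{\vee}_n$. $\mathcal E$ has finite projective global dimension if $\mathcal E=(\mathcal P_{\mathcal E})^{\wedge}_n$ for some natural number $n$. A subcategory $\mathcal T$ is $n$-tilting ($n\ge1$) if (P1) $\mathrm{pd}_{\mathcal E}\mathcal T\le n$; (P2) $\mathbb E^i_{\mathcal E}(\mathcal T,\mathcal T)=0$ for $i=1,\dots,n$; (P3) every projective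 $P$ admits $\mathbb E_{\mathcal E}$-triangles $P\to T_0\to R_1\dashrightarrow$, $R_1\to T_1\to R_2\dashrightarrow$, …, $R_{n-1}\to T_{n-1}\to T_n\dashrightarrow$ with all $T_i\in\mathcal T$. Dually, $\mathcal T$ is $n$-cotilting if $\mathrm{id}_{\mathcal E}\mathcal T\le n$, $\mathbb E^i_{\mathcal E}(\mathcal T,\mathcal T)=0$ for $i=1,\dots,n$, and every injective $I$ admits $\mathbb E_{\mathcal E}$-triangles $R_1\to T_0\to I\dashrightarrow$, $R_2\to T_1\to R_1\dashrightarrow$, …, $T_n\to T_{n-1}\to R_{n-1}\dashrightarrow$ with all $T_i\in\mathcal T$. Generalized tilting (cotilting) means $n$-tilting ($n$-cotilting) for some $n\ge1$. A pair $(\mathcal U,\mathcal V)$ of subcategories is a cotorsion pair if $\mathbb E_{\mathcal E}(\mathcal U,\mathcal V)=0$ and every $B\in\mathcal E$ admits $\mathbb E_{\mathcal E}$-triangles $V_B\to U_B\to B\dashrightarrow$ and $B\to V^B\to U^B\dashrightarrow$ with $U_B,U^B\in\mathcal U$, $V_B,V^B\in\mathcal V$. It is hereditary if $\mathbb E^2_{\mathcal E}(\mathcal U,\mathcal V)=0$. A hereditary cotorsion pair $(\mathcal U,\mathcal V)$ with $\mathcal T=\mathcal U\cap\mathcal V$ is a tilting cotorsion pair if $\mathcal T$ is generalized tilting, $\mathcal U=\mathcal T^{\vee}$ and $\mathcal V=\mathcal T^{\bot}$; it is a cotilting cotorsion pair if $\mathcal T$ is generalized cotilting, $\mathcal V=\mathcal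 T^{\wedge}$ and $\mathcal U={}^{\bot}\mathcal T$. Glued cotorsion pair. Given cotorsion pairs $(\mathcal U_1,\mathcal V_1)$ in $\mathcal A$ and $(\mathcal U_3,\mathcal V_3)$ in $\mathcal C$, the glued cotorsion pair in $\mathcal B$ is $(\mathcal U_2,\mathcal V_2)$ with $\mathcal V_2=\{B\in\mathcal B\mid i^!B\in\mathcal V_1,\ j^*B\in\mathcal V_3\}$ and $\mathcal U_2={}^{\bot_1}\mathcal V_2$ (this is a cotorsion pair in $\mathcal B$ under the hypotheses on the recollement). *)

(* Defs.v *)
From HB Require Import structures.
From mathcomp Require Import all_boot all_order all_algebra.

Set Implicit Arguments.
Unset Strict Implicit.
Unset Printing Implicit Defensive.

Import GRing.Theory.
Local Open Scope ring_scope.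

Declare Scope cat_scope.
Delimit Scope cat_scope with cat.
Open Scope cat_scope.

(** * Hom-finite k-linear categories *)

(* Hom-finiteness is carried by the codomain [vectType k] of [hom]. *)
Record linCat (k : fieldType) := LinCat {
  obj :> Type;
  hom : obj -> obj -> vectType k;
  idm : forall X : obj, hom X X;
  comp : forall X Y Z : obj, hom Y Z -> hom X Y -> hom X Z;
  comp_idl : forall (X Y : obj) (f : hom X Y), comp (idm Y) f = f;
  comp_idr : forall (X Y : obj) (f : hom X Y), comp f (idm X) = f;
  comp_assoc : forall (X Y Z W : obj) (h : hom Z W) (g : hom Y Z) (f : hom X Y),
    comp h (comp g f) = comp (comp h g) f;
  comp_linl : forall (X Y Z : obj) (a : k) (g g' : hom Y Z) (f : hom X Y),
    comp (a *: g + g') f = a *: comp g f + comp g' f;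
  comp_linr : forall (X Y Z : obj) (a : k) (g : hom Y Z) (f f' : hom X Y),
    comp g (a *: f + f') = a *: comp g f + comp g f'
}.
Arguments hom {k l} X Y.
Arguments idm {k l} X.
Arguments comp {k l X Y Z} g f.

Notation "g ∘ f" := (comp g f) (at level 40, left associativity) : cat_scope.

Section LinCat.
Context {k : fieldType} {E : linCat k}.

Definition is_iso (X Y : E) (f : hom X Y) : Prop :=
  exists g : hom Y X, g ∘ f = idm X /\ f ∘ g = idm Y.

Definition isomorphic (X Y : E) : Prop := exists f : hom X Y, is_iso f.

Definition is_zero (X : E) : Prop :=
  (forall (Y : E) (f : hom X Y), f = 0) /\ (forall (Y : E) (f : hom Y X), f = 0).

Definition is_biprod (X Y S : E) (i1 : hom X S) (i2 : hom Y S)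
    (p1 : hom S X) (p2 : hom S Y) : Prop :=
  [/\ p1 ∘ i1 = idm X, p2 ∘ i2 = idm Y, p2 ∘ i1 = 0, p1 ∘ i2 = 0
    & i1 ∘ p1 + i2 ∘ p2 = idm S].

Definition biprod (X Y S : E) : Prop :=
  exists (i1 : hom X S) (i2 : hom Y S) (p1 : hom S X) (p2 : hom S Y),
    is_biprod i1 i2 p1 p2.

(* The non-invertible endomorphisms of a nonzero object are closed under sums. *)
Definition local_end (X : E) : Prop :=
  idm X <> 0 /\
  forall f g : hom X X, ~ is_iso f -> ~ is_iso g -> ~ is_iso (f + g).

(* A full subcategory closed under isomorphisms, finite direct sums (including
   the empty one) and direct summands. *)
Definition is_subcat (D : E -> Prop) : Prop :=
  [/\ forall X Y : E, isomorphic X Y -> D X -> D Y,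
      forall X : E, is_zero X -> D X,
      forall X Y S : E, biprod X Y S -> D X -> D Y -> D S
    & forall X Y S : E, biprod X Y S -> D S -> D X /\ D Y].

End LinCat.

Definition additive_cat (k : fieldType) (E : linCat k) : Prop :=
  (exists X : E, is_zero X) /\ (forall X Y : E, exists S : E, biprod X Y S).

Definition krull_schmidt (k : fieldType) (E : linCat k) : Prop :=
  forall X : E, exists (n : nat) (Y : 'I_n -> E)
      (i : forall a, hom (Y a) X) (p : forall a, hom X (Y a)),
    [/\ forall a, local_end (Y a),
        forall a, p a ∘ i a = idm (Y a),
        forall a b, a != b -> p a ∘ i b = 0
      & \sum_(a < n) i a ∘ p a = idm X].

(** * Extriangulated categories *)

(* [Ext X Y] is E(X, Y), [push a d] is a_* d and [pull c d] is c^* d.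
   [realizes d x y] states that the sequence (x, y) belongs to the equivalence
   class s(d). *)
Record extCat (k : fieldType) := ExtCat {
  ext_cat :> linCat k;
  Ext : ext_cat -> ext_cat -> lmodType k;
  push : forall X Y Y' : ext_cat, hom Y Y' -> Ext X Y -> Ext X Y';
  pull : forall X' X Y : ext_cat, hom X' X -> Ext X Y -> Ext X' Y;
  realizes : forall X Y Z : ext_cat, Ext Z X -> hom X Y -> hom Y Z -> Prop
}.
Arguments Ext {k e} X Y.
Arguments push {k e X Y Y'} a d.
Arguments pull {k e X' X Y} c d.
Arguments realizes {k e X Y Z} d x y.

Section ExtLaws.
Context {k : fieldType} (E : extCat k).

(* E is a k-bilinear functor from E^op x E to k-modules. *)
Record ext_bifunctor : Prop := ExtBifunctor {
  push_lin : forall (X Y Y' : E) (a : hom Y Y') (r : k) (d d' : Ext X Y),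
    push a (r *: d + d') = r *: push a d + push a d';
  pull_lin : forall (X' X Y : E) (c : hom X' X) (r : k) (d d' : Ext X Y),
    pull c (r *: d + d') = r *: pull c d + pull c d';
  push_linm : forall (X Y Y' : E) (r : k) (a a' : hom Y Y') (d : Ext X Y),
    push (r *: a + a') d = r *: push a d + push a' d;
  pull_linm : forall (X' X Y : E) (r : k) (c c' : hom X' X) (d : Ext X Y),
    pull (r *: c + c') d = r *: pull c d + pull c' d;
  push_id : forall (X Y : E) (d : Ext X Y), push (idm Y) d = d;
  pull_id : forall (X Y : E) (d : Ext X Y), pull (idm X) d = d;
  push_comp : forall (X Y Y' Y'' : E) (a' : hom Y' Y'') (a : hom Y Y')
    (d : Ext X Y), push (a' ∘ a) d = push a' (push a d);
  pull_comp : forall (X'' X' X Y : E) (c : hom X' X) (c' : hom X'' X')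
    (d : Ext X Y), pull (c ∘ c') d = pull c' (pull c d);
  push_pull : forall (X' X Y Y' : E) (a : hom Y Y') (c : hom X' X)
    (d : Ext X Y), push a (pull c d) = pull c (push a d)
}.

(* s(d) is exactly one equivalence class of sequences, and every morphism of
   extensions is realized by a morphism of sequences. *)
Record is_realization : Prop := IsRealization {
  realizes_ex : forall (X Z : E) (d : Ext Z X),
    exists (Y : E) (x : hom X Y) (y : hom Y Z), realizes d x y;
  realizes_equiv : forall (X Z : E) (d : Ext Z X) (Y Y' : E)
    (x : hom X Y) (y : hom Y Z) (x' : hom X Y') (y' : hom Y' Z),
    realizes d x y ->
    (realizes d x' y' <->
     exists b : hom Y Y', [/\ is_iso b, b ∘ x = x' & y' ∘ b = y]);
  realizes_mor : forall (X Y Z X' Y' Z' : E) (d : Ext Z X) (d' : Ext Z' X')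
    (x : hom X Y) (y : hom Y Z) (x' : hom X' Y') (y' : hom Y' Z')
    (a : hom X X') (c : hom Z Z'),
    realizes d x y -> realizes d' x' y' -> push a d = pull c d' ->
    exists b : hom Y Y', b ∘ x = x' ∘ a /\ y' ∘ b = c ∘ y
}.

(* s(0) is the split sequence and s(d + d') = s(d) + s(d') for direct sums. *)
Record additive_realization : Prop := AdditiveRealization {
  realizes_split : forall (X Z S : E) (i1 : hom X S) (i2 : hom Z S)
    (p1 : hom S X) (p2 : hom S Z),
    is_biprod i1 i2 p1 p2 -> realizes (0 : Ext Z X) i1 p2;
  realizes_sum : forall (X Y Z X' Y' Z' : E) (d : Ext Z X) (d' : Ext Z' X')
    (x : hom X Y) (y : hom Y Z) (x' : hom X' Y') (y' : hom Y' Z')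
    (SX SY SZ : E)
    (iX : hom X SX) (iX' : hom X' SX) (pX : hom SX X) (pX' : hom SX X')
    (iY : hom Y SY) (iY' : hom Y' SY) (pY : hom SY Y) (pY' : hom SY Y')
    (iZ : hom Z SZ) (iZ' : hom Z' SZ) (pZ : hom SZ Z) (pZ' : hom SZ Z'),
    is_biprod iX iX' pX pX' -> is_biprod iY iY' pY pY' ->
    is_biprod iZ iZ' pZ pZ' ->
    realizes d x y -> realizes d' x' y' ->
    realizes (push iX (pull pZ d) + push iX' (pull pZ' d'))
      (iY ∘ x ∘ pX + iY' ∘ x' ∘ pX') (iZ ∘ y ∘ pY + iZ' ∘ y' ∘ pY')
}.

Definition ET3 : Prop :=
  forall (X Y Z X' Y' Z' : E) (d : Ext Z X) (d' : Ext Z' X')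
    (x : hom X Y) (y : hom Y Z) (x' : hom X' Y') (y' : hom Y' Z')
    (a : hom X X') (b : hom Y Y'),
    realizes d x y -> realizes d' x' y' -> b ∘ x = x' ∘ a ->
    exists c : hom Z Z', c ∘ y = y' ∘ b /\ push a d = pull c d'.

Definition ET3op : Prop :=
  forall (X Y Z X' Y' Z' : E) (d : Ext Z X) (d' : Ext Z' X')
    (x : hom X Y) (y : hom Y Z) (x' : hom X' Y') (y' : hom Y' Z')
    (b : hom Y Y') (c : hom Z Z'),
    realizes d x y -> realizes d' x' y' -> c ∘ y = y' ∘ b ->
    exists a : hom X X', b ∘ x = x' ∘ a /\ push a d = pull c d'.

(*  A --f--> B --f'-> D        rows A B D, A C G; columns B C F, D G F
    |        |g       |d
    A -g∘f-> C --h'-> G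
             |g'      |e
             F ====== F   *)
Definition ET4 : Prop :=
  forall (A B C D F : E) (d1 : Ext D A) (d2 : Ext F B)
    (f : hom A B) (f' : hom B D) (g : hom B C) (g' : hom C F),
    realizes d1 f f' -> realizes d2 g g' ->
    exists (G : E) (d : hom D G) (e : hom G F) (h' : hom C G) (d3 : Ext G A),
      [/\ realizes d3 (g ∘ f) h', h' ∘ g = d ∘ f', e ∘ h' = g',
          realizes (push f' d2) d e
        & pull d d3 = d1 /\ push f d3 = pull e d2].

(*  D --d--> G --e--> F        rows D G F, D A B; columns G A C, F B C
    |        |h'      |g'
    D --f'-> A --f--> B
             |g∘f     |g
             C ====== C   *)
Definition ET4op : Prop :=
  forall (A B C D F : E) (d1 : Ext B D) (d2 : Ext C F)
    (f' : hom D A) (f : hom A B) (g' : hom F B) (g : hom B C),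
    realizes d1 f' f -> realizes d2 g' g ->
    exists (G : E) (d : hom D G) (e : hom G F) (h' : hom G A) (d3 : Ext C G),
      [/\ realizes d3 h' (g ∘ f), h' ∘ d = f', f ∘ h' = g' ∘ e,
          realizes (pull g' d1) d e
        & push e d3 = d2 /\ push d d1 = pull g d3].

End ExtLaws.

Record extriCat (k : fieldType) := ExtriCat {
  extri_cat :> extCat k;
  extri_additive : additive_cat extri_cat;
  extri_bifunctor : ext_bifunctor extri_cat;
  extri_realization : is_realization extri_cat;
  extri_additive_realization : additive_realization extri_cat;
  extri_ET3 : ET3 extri_cat;
  extri_ET3op : ET3op extri_cat;
  extri_ET4 : ET4 extri_cat;
  extri_ET4op : ET4op extri_cat
}.

Section Extri.
Context {k : fieldType} {E : extriCat k}.

Definition Etriangle (X Y Z : E) (x : hom X Y) (y : hom Y Z) : Prop :=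
  exists d : Ext Z X, realizes d x y.

Definition inflation (X Y : E) (f : hom X Y) : Prop :=
  exists (Z : E) (y : hom Y Z), Etriangle f y.

Definition deflation (Y Z : E) (g : hom Y Z) : Prop :=
  exists (X : E) (x : hom X Y), Etriangle x g.

Definition compatible (X Y : E) (f : hom X Y) : Prop :=
  inflation f -> deflation f -> is_iso f.

Definition right_exact_seq (X Y Z : E) (f : hom X Y) (g : hom Y Z) : Prop :=
  exists (K : E) (h1 : hom X K) (h2 : hom K Y),
    [/\ Etriangle h2 g, deflation h1, compatible h1 & f = h2 ∘ h1].

Definition left_exact_seq (X Y Z : E) (f : hom X Y) (g : hom Y Z) : Prop :=
  exists (K : E) (h1 : hom Y K) (h2 : hom K Z),
    [/\ Etriangle f h1, inflation h2, compatible h2 & g = h2 ∘ h1].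

Definition right_exact_triangle_seq (X Y Z W : E)
    (f : hom X Y) (g : hom Y Z) (h : hom Z W) : Prop :=
  exists (K : E) (g1 : hom Y K) (g2 : hom K Z),
    [/\ Etriangle f g1, Etriangle g2 h, g = g2 ∘ g1 & compatible g1].

Definition left_exact_triangle_seq (X Y Z W : E)
    (f : hom X Y) (g : hom Y Z) (h : hom Z W) : Prop :=
  exists (K : E) (g1 : hom Y K) (g2 : hom K Z),
    [/\ Etriangle f g1, Etriangle g2 h, g = g2 ∘ g1 & compatible g2].

(** ** Projectives, injectives and higher extensions *)

Definition projective (P : E) : Prop :=
  forall (X Y Z : E) (x : hom X Y) (y : hom Y Z), Etriangle x y ->
  forall c : hom P Z, exists b : hom P Y, y ∘ b = c.

Definition injective_obj (I : E) : Prop :=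
  forall (X Y Z : E) (x : hom X Y) (y : hom Y Z), Etriangle x y ->
  forall a : hom X I, exists b : hom Y I, b ∘ x = a.

(* [syzygy i X Z]: Z is one of the objects Omega^i X. *)
Fixpoint syzygy (i : nat) (X Z : E) : Prop :=
  if i is j.+1 then
    exists (Y P : E) (x : hom Z P) (y : hom P Y),
      [/\ syzygy j X Y, projective P & Etriangle x y]
  else Z = X.

(* E^i(X, Y) = 0 for i >= 1, where E^{i+1}(X, Y) = E(Omega^i X, Y). *)
Definition ext_vanish (i : nat) (X Y : E) : Prop :=
  forall Z : E, syzygy i.-1 X Z -> forall d : Ext Z Y, d = 0.

Implicit Types D T U V : E -> Prop.

Definition right_perp D (X : E) : Prop :=
  forall i, (0 < i)%N -> forall Y, D Y -> ext_vanish i Y X.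

Definition left_perp D (X : E) : Prop :=
  forall i, (0 < i)%N -> forall Y, D Y -> ext_vanish i X Y.

Definition left_perp1 D (X : E) : Prop :=
  forall Y, D Y -> forall d : Ext X Y, d = 0.

(** ** Resolution dimensions *)

Fixpoint wedge_n D (i : nat) (Y : E) : Prop :=
  if i is j.+1 then
    exists (C D0 : E) (x : hom C D0) (y : hom D0 Y),
      [/\ Etriangle x y, wedge_n D j C & D D0]
  else D Y.

Fixpoint vee_n D (i : nat) (X : E) : Prop :=
  if i is j.+1 then
    exists (D0 C : E) (x : hom X D0) (y : hom D0 C),
      [/\ Etriangle x y, D D0 & vee_n D j C]
  else D X.

Definition wedge D (X : E) : Prop := exists i, wedge_n D i X.

Definition vee D (X : E) : Prop := exists i, vee_n D i X.

Definition pd_le D (n : nat) : Prop := forall X, D X -> wedge_n projective n X.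

Definition id_le D (n : nat) : Prop := forall X, D X -> vee_n injective_obj n X.

(** ** Tilting subcategories and cotorsion pairs *)

(* The chains of E-triangles P -> T_0 -> R_1, ..., R_{n-1} -> T_{n-1} -> T_n
   in [tilting_cores] are what [vee_n T n P] unfolds to. *)
Record n_tilting (n : nat) T : Prop := NTilting {
  tilting_subcat : is_subcat T;
  tilting_pd : pd_le T n;
  tilting_ext : forall i, (1 <= i <= n)%N ->
    forall X Y, T X -> T Y -> ext_vanish i X Y;
  tilting_cores : forall P : E, projective P -> vee_n T n P
}.

Record n_cotilting (n : nat) T : Prop := NCotilting {
  cotilting_subcat : is_subcat T;
  cotilting_id : id_le T n;
  cotilting_ext : forall i, (1 <= i <= n)%N ->
    forall X Y, T X -> T Y -> ext_vanish i X Y;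
  cotilting_res : forall I : E, injective_obj I -> wedge_n T n I
}.

Definition generalized_tilting T : Prop :=
  exists2 n : nat, (1 <= n)%N & n_tilting n T.

Definition generalized_cotilting T : Prop :=
  exists2 n : nat, (1 <= n)%N & n_cotilting n T.

Record cotorsion_pair U V : Prop := CotorsionPair {
  cotorsion_subcatl : is_subcat U;
  cotorsion_subcatr : is_subcat V;
  cotorsion_ext : forall X Y, U X -> V Y -> forall d : Ext X Y, d = 0;
  cotorsion_cover : forall B : E, exists (VB UB : E)
    (x : hom VB UB) (y : hom UB B), [/\ Etriangle x y, V VB & U UB];
  cotorsion_envelope : forall B : E, exists (VB UB : E)
    (x : hom B VB) (y : hom VB UB), [/\ Etriangle x y, V VB & U UB]
}.

Definition hereditary_cotorsion_pair U V : Prop :=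
  cotorsion_pair U V /\ forall X Y, U X -> V Y -> ext_vanish 2 X Y.

Definition core U V (X : E) : Prop := U X /\ V X.

Definition tilting_cotorsion_pair U V : Prop :=
  [/\ hereditary_cotorsion_pair U V,
      generalized_tilting (core U V),
      forall X, U X <-> vee (core U V) X
    & forall X, V X <-> right_perp (core U V) X].

Definition cotilting_cotorsion_pair U V : Prop :=
  [/\ hereditary_cotorsion_pair U V,
      generalized_cotilting (core U V),
      forall X, V X <-> wedge (core U V) X
    & forall X, U X <-> left_perp (core U V) X].

End Extri.

Section Global.
Context {k : fieldType} (E : extriCat k).

Definition WIC : Prop :=
  (forall (X Y Z : E) (g : hom Y Z) (f : hom X Y),
     deflation (g ∘ f) -> deflation g) /\
  (forall (X Y Z : E) (g : hom Y Z) (f : hom X Y),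
     inflation (g ∘ f) -> inflation f).

Definition enough_projectives : Prop :=
  forall Z : E, exists (X P : E) (x : hom X P) (y : hom P Z),
    Etriangle x y /\ projective P.

Definition enough_injectives : Prop :=
  forall X : E, exists (I Z : E) (x : hom X I) (y : hom I Z),
    Etriangle x y /\ injective_obj I.

Definition finite_projective_global_dim : Prop :=
  exists n : nat, forall X : E, wedge_n projective n X.

End Global.

(** * Functors and recollements *)

Record addFunctor (k : fieldType) (E F : linCat k) := AddFunctor {
  fobj :> E -> F;
  fmor : forall X Y : E, hom X Y -> hom (fobj X) (fobj Y);
  fmor_id : forall X : E, fmor (idm X) = idm (fobj X);
  fmor_comp : forall (X Y Z : E) (g : hom Y Z) (f : hom X Y),
    fmor (g ∘ f) = fmor g ∘ fmor f;
  fmor_add : forall (X Y : E) (f g : hom X Y), fmor (f + g) = fmor f + fmor g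
}.
Arguments fmor {k E F} G {X Y} f : rename.

Record adjunction (k : fieldType) (E F : linCat k)
    (L : addFunctor E F) (R : addFunctor F E) := Adjunction {
  unit : forall X : E, hom X (R (L X));
  counit : forall Y : F, hom (L (R Y)) Y;
  unit_nat : forall (X X' : E) (f : hom X X'),
    unit X' ∘ f = fmor R (fmor L f) ∘ unit X;
  counit_nat : forall (Y Y' : F) (g : hom Y Y'),
    counit Y' ∘ fmor L (fmor R g) = g ∘ counit Y;
  counit_unit : forall X : E, counit (L X) ∘ fmor L (unit X) = idm (L X);
  unit_counit : forall Y : F, fmor R (counit Y) ∘ unit (R Y) = idm (R Y)
}.
Arguments unit {k E F L R} a X : rename.
Arguments counit {k E F L R} a Y : rename.

Definition fully_faithful (k : fieldType) (E F : linCat k)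
    (G : addFunctor E F) : Prop :=
  forall X Y : E, bijective (@fmor k E F G X Y).

Section Exactness.
Context {k : fieldType} {E F : extriCat k} (G : addFunctor E F).

Definition exact_functor : Prop :=
  forall (X Y Z : E) (f : hom X Y) (g : hom Y Z),
    Etriangle f g -> Etriangle (fmor G f) (fmor G g).

Definition preserves_compatible : Prop :=
  forall (X Y : E) (f : hom X Y), compatible f -> compatible (fmor G f).

Definition right_exact_functor : Prop :=
  preserves_compatible /\
  forall (X Y Z : E) (f : hom X Y) (g : hom Y Z),
    right_exact_seq f g -> right_exact_seq (fmor G f) (fmor G g).

Definition left_exact_functor : Prop :=
  preserves_compatible /\
  forall (X Y Z : E) (f : hom X Y) (g : hom Y Z),
    left_exact_seq f g -> left_exact_seq (fmor G f) (fmor G g).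

End Exactness.

Record recollement (k : fieldType) (A B C : extriCat k) := Recollement {
  i_us : addFunctor B A;   (* i^* *)
  i_ls : addFunctor A B;   (* i_* *)
  i_sh : addFunctor B A;   (* i^! *)
  j_sh : addFunctor C B;   (* j_! *)
  j_us : addFunctor B C;   (* j^* *)
  j_ls : addFunctor C B;   (* j_* *)
  i_ls_exact : exact_functor i_ls;
  j_us_exact : exact_functor j_us;
  i_us_rexact : right_exact_functor i_us;
  j_sh_rexact : right_exact_functor j_sh;
  i_sh_lexact : left_exact_functor i_sh;
  j_ls_lexact : left_exact_functor j_ls;
  adj_i_us : adjunction i_us i_ls;
  adj_i_sh : adjunction i_ls i_sh;
  adj_j_sh : adjunction j_sh j_us;
  adj_j_ls : adjunction j_us j_ls;
  (* Im i_* is the essential image. *)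
  im_i_ker_j : forall X : B,
    (exists Y : A, isomorphic (i_ls Y) X) <-> is_zero (j_us X);
  i_ls_ff : fully_faithful i_ls;
  j_sh_ff : fully_faithful j_sh;
  j_ls_ff : fully_faithful j_ls;
  rec_left : forall X : B, exists (A0 : A) (h : hom (j_ls (j_us X)) (i_ls A0)),
    left_exact_triangle_seq (counit adj_i_sh X) (unit adj_j_ls X) h;
  rec_right : forall X : B, exists (A0 : A) (h : hom (i_ls A0) (j_sh (j_us X))),
    right_exact_triangle_seq h (counit adj_j_sh X) (unit adj_i_us X)
}.

Section Glue.
Context {k : fieldType} {A B C : extriCat k} (R : recollement A B C).

Definition glued_V (V1 : A -> Prop) (V3 : C -> Prop) (X : B) : Prop :=
  V1 (i_sh R X) /\ V3 (j_us R X).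

Definition glued_U (V1 : A -> Prop) (V3 : C -> Prop) : B -> Prop :=
  left_perp1 (glued_V V1 V3).

End Glue.

(* Main.v *)
From HB Require Import structures.
From mathcomp Require Import all_boot all_order all_algebra.
From Stdlib Require Import Setoid.
Require Import Defs.

(** In a category with enough projectives and injectives, a hereditary cotorsion
pair (U, V) is cotilting iff E^m(-, V) = 0 for all large m, and dually it is
tilting iff E^m(U, -) = 0 for all large m; so only these bounds have to be
transported along the recollement.

Exactness of i^! makes i_*i^!X -> X -> j_*j^*X an E-triangle and j_* exact.
Hence the adjunctions i_* -| i^!, j_! -| j^* and j^* -| j_* consist of exact
functors, and each transports the vanishing of all E^m. For V in V_2 the bound follows
from i_*i^!V -> V -> j_*j^*V, where E^m(X, i_*i^!V) is computed by resolving X by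
i_*A' -> j_!j^*X -> X -> i_*i^*X; for U in U_2 it follows from the latter sequence,
the terms in the image of i_* being controlled by the global dimension of A.

A V_2-envelope of X is built in two steps: first glue in an envelope of j^*X
along j_!, then an envelope of i^!Y along i_*. As exact functors are not assumed
to act on extensions, pushouts are replaced by common-start octahedra. *)

Set Implicit Arguments.
Unset Strict Implicit.
Unset Printing Implicit Defensive.
Import GRing.Theory.

(** * Linear categories: additivity of composition, isomorphisms, biproducts *)

Section LinearCategory.
Local Open Scope ring_scope.
Context {k : fieldType} {E : linCat k}.
Implicit Types X Y Z W S : E.

Lemma compDl X Y Z (g g' : hom Y Z) (f : hom X Y) :
  (g + g') ∘ f = g ∘ f + g' ∘ f.
Proof. by have := comp_linl 1 g g' f; rewrite !scale1r. Qed.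

Lemma compDr X Y Z (g : hom Y Z) (f f' : hom X Y) :
  g ∘ (f + f') = g ∘ f + g ∘ f'.
Proof. by have := comp_linr 1 g f f'; rewrite !scale1r. Qed.

Lemma comp0l X Y Z (f : hom X Y) : (0 : hom Y Z) ∘ f = 0.
Proof. by apply: (@addrI _ (0 ∘ f)); rewrite -compDl !addr0. Qed.

Lemma comp0r X Y Z (g : hom Y Z) : g ∘ (0 : hom X Y) = 0.
Proof. by apply: (@addrI _ (g ∘ 0)); rewrite -compDr !addr0. Qed.

Lemma compNr X Y Z (g : hom Y Z) (f : hom X Y) : g ∘ (- f) = - (g ∘ f).
Proof. by apply/eqP; rewrite -addr_eq0 -compDr addNr comp0r. Qed.

Lemma compBr X Y Z (g : hom Y Z) (f f' : hom X Y) :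
  g ∘ (f - f') = g ∘ f - g ∘ f'.
Proof. by rewrite compDr compNr. Qed.

Lemma id0_zero X : idm X = 0 -> is_zero X.
Proof.
move=> X0; split=> Y f; first by rewrite -(comp_idr f) X0 comp0r.
by rewrite -(comp_idl f) X0 comp0l.
Qed.

Lemma zero_id0 X : is_zero X -> idm X = 0.
Proof. by case. Qed.

Lemma is_iso_id X : is_iso (idm X).
Proof. by exists (idm X); rewrite comp_idl. Qed.

Lemma is_iso_comp X Y Z (g : hom Y Z) (f : hom X Y) :
  is_iso g -> is_iso f -> is_iso (g ∘ f).
Proof.
case=> g' [g'g gg'] [f' [f'f ff']]; exists (f' ∘ g'); split.
  by rewrite -comp_assoc (comp_assoc g') g'g comp_idl.
by rewrite -comp_assoc (comp_assoc f) ff' comp_idl.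
Qed.

Lemma is_iso_inv X Y (f : hom X Y) :
  is_iso f -> exists2 g : hom Y X, is_iso g & g ∘ f = idm X /\ f ∘ g = idm Y.
Proof. by case=> g [gf fg]; exists g => //; exists f. Qed.

Lemma isomorphic_sym X Y : isomorphic X Y -> isomorphic Y X.
Proof. by case=> f /is_iso_inv[g g_iso _]; exists g. Qed.

Lemma isomorphic_trans X Y Z :
  isomorphic X Y -> isomorphic Y Z -> isomorphic X Z.
Proof. by case=> f fi [g gi]; exists (g ∘ f); apply: is_iso_comp. Qed.

Lemma is_iso_zero X Y (f : hom X Y) : is_iso f -> is_zero X -> is_zero Y.
Proof.
by case=> g [gf fg] X0; apply: id0_zero; rewrite -fg (X0.2 _ g) comp0r.
Qed.

Lemma isomorphic_zero X Y : isomorphic X Y -> is_zero X -> is_zero Y.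
Proof. by case=> f; apply: is_iso_zero. Qed.

Lemma left_right_inv_iso X Y (f : hom X Y) (g h : hom Y X) :
  g ∘ f = idm X -> f ∘ h = idm Y -> is_iso f.
Proof.
move=> gf fh; exists g; split=> //.
by rewrite -[in LHS](comp_idr g) -fh (comp_assoc g) gf comp_idl.
Qed.

Lemma retraction_iso X Y (f : hom X Y) (g : hom Y X) :
  is_iso f -> g ∘ f = idm X -> is_iso g.
Proof.
case=> h [hf fh] gf; exists f; split=> //.
by rewrite -[g]comp_idr -fh (comp_assoc g) gf comp_idl.
Qed.

Lemma biprod_sym X Y S (i1 : hom X S) (i2 : hom Y S) (p1 : hom S X)
    (p2 : hom S Y) : is_biprod i1 i2 p1 p2 -> is_biprod i2 i1 p2 p1.
Proof. by case=> *; split=> //; rewrite addrC. Qed.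

Lemma biprod_zero X Z : is_zero Z ->
  is_biprod (idm X) (0 : hom Z X) (idm X) (0 : hom X Z).
Proof.
move=> Z0; split; rewrite ?comp_idl ?comp0l ?comp0r ?addr0 //.
by rewrite zero_id0.
Qed.

End LinearCategory.

(** * The opposite extriangulated category *)

Section Opposite.
Local Open Scope ring_scope.
Context {k : fieldType}.

Definition op_lin (E : linCat k) : linCat k.
Proof.
refine (@LinCat k (obj E) (fun X Y => @hom k E Y X) (fun X => idm X)
  (fun X Y Z g f => f ∘ g) _ _ _ _ _).
- by move=> X Y f; apply: comp_idr.
- by move=> X Y f; apply: comp_idl.
- by move=> X Y Z W h g f; rewrite comp_assoc.
- by move=> X Y Z a g g' f; rewrite comp_linr.
- by move=> X Y Z a g f f'; rewrite comp_linl.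
Defined.

Definition op_ext (E : extCat k) : extCat k :=
  @ExtCat k (op_lin E) (fun X Y : E => Ext Y X)
    (fun X Y Y' (a : @hom k E Y' Y) d => pull a d)
    (fun X' X Y (c : @hom k E X X') d => push c d)
    (fun X Y Z d x y => realizes d y x).

Lemma op_iso (E : linCat k) (X Y : E) (f : hom X Y) :
  is_iso (f : @hom k (op_lin E) Y X) <-> is_iso f.
Proof. by split; case=> g [gf fg]; exists g. Qed.

Lemma op_biprod (E : linCat k) (X Y S : E) (i1 : hom X S) (i2 : hom Y S)
    (p1 : hom S X) (p2 : hom S Y) : is_biprod i1 i2 p1 p2 ->
  @is_biprod k (op_lin E) X Y S p1 p2 i1 i2.
Proof. by case=> *; split. Qed.

Lemma op_biprodV (E : linCat k) (X Y S : E) (i1 : hom X S) (i2 : hom Y S)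
    (p1 : hom S X) (p2 : hom S Y) :
  @is_biprod k (op_lin E) X Y S p1 p2 i1 i2 -> is_biprod i1 i2 p1 p2.
Proof. by case=> *; split. Qed.

(** Closed by [Defined], so that objects, maps and extensions of [op E] convert to those of [E],
    also for [op (op E)]: a lemma instantiated at [op E] is read back as its dual. ET3 and ET3op
    trade places, as do ET4 and ET4op. *)
Definition op (E : extriCat k) : extriCat k.
Proof.
apply: (@ExtriCat k (op_ext E)).
- case: (extri_additive E) => -[O O0] sum; split.
    by exists O; split; [exact: O0.2 | exact: O0.1].
  move=> X Y; have [S [i1 [i2 [p1 [p2 /op_biprod bp]]]]] := sum X Y.
  by exists S, p1, p2, i1, i2.
- have [h1 h2 h3 h4 h5 h6 h7 h8 h9] := extri_bifunctor E.
  split=> /= *; rewrite ?h2 ?h1 ?h4 ?h3 ?h6 ?h5 ?h8 ?h7 ?h9 //.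
- have [h1 h2 h3] := extri_realization E; split=> /=.
  + by move=> X Z d; have [Y [x [y r]]] := h1 _ _ d; exists Y, y, x.
  + move=> X Z d Y Y' x y x' y' r; have h := h2 _ _ _ _ _ _ _ y' x' r.
    split=> [/h|] [b [[b' [/= b'b bb']] bx yb]]; last apply/h; exists b'; split.
    * by exists b.
    * by rewrite -yb -comp_assoc bb' comp_idr.
    * by rewrite -bx comp_assoc b'b comp_idl.
    * by exists b.
    * by rewrite -yb /= comp_assoc bb' comp_idl.
    * by rewrite -bx /= -comp_assoc b'b comp_idr.
  + move=> X Y Z X' Y' Z' d d' x y x' y' a c r r' e.
    by have [b [b1 b2]] := h3 _ _ _ _ _ _ _ _ _ _ _ _ c a r' r (esym e); exists b.
- have [h1 h2] := extri_additive_realization E; split=> /=.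
    by move=> X Z S i1 i2 p1 p2 /op_biprodV/biprod_sym bp; apply: h1 bp.
  move=> X Y Z X' Y' Z' d d' x y x' y' SX SY SZ iX iX' pX pX' iY iY' pY pY'
    iZ iZ' pZ pZ' /op_biprodV bX /op_biprodV bY /op_biprodV bZ r r'.
  have := h2 _ _ _ _ _ _ _ _ _ _ _ _ _ _ _ _ _ _ _ _ _ _ _ _ _ _ _ bZ bY bX r r'.
  by rewrite !comp_assoc !(push_pull (extri_bifunctor E)).
- move=> X Y Z X' Y' Z' d d' x y x' y' a b r r' e.
  by have [c [c1 c2]] := extri_ET3op r' r (esym e); exists c.
- move=> X Y Z X' Y' Z' d d' x y x' y' a b r r' e.
  by have [c [c1 c2]] := extri_ET3 r' r (esym e); exists c.
- move=> A B C D F d1 d2 f f' g g' r1 r2.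
  have [G [d [e [h [d3 [a1 a2 a3 a4 [a5 a6]]]]]]] := extri_ET4op r2 r1.
  by exists G, e, d, h, d3; split.
- move=> A B C D F d1 d2 f f' g g' r1 r2.
  have [G [d [e [h [d3 [a1 a2 a3 a4 [a5 a6]]]]]]] := extri_ET4 r2 r1.
  by exists G, e, d, h, d3; split.
Defined.

End Opposite.

(** * The bifunctor of extensions and its exact sequences *)

Section Exactness.
Local Open Scope ring_scope.
Context {k : fieldType} {E : extriCat k}.
Implicit Types X Y Z W : E.

Lemma pushD X Y Y' (a : hom Y Y') (d d' : Ext X Y) :
  push a (d + d') = push a d + push a d'.
Proof. by have := push_lin (extri_bifunctor E) a 1 d d'; rewrite !scale1r. Qed.

Lemma push0 X Y Y' (a : hom Y Y') : push a (0 : Ext X Y) = 0.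
Proof. by apply: (@addrI _ (push a 0)); rewrite -pushD !addr0. Qed.

Lemma push0l X Y Y' (d : Ext X Y) : push (0 : hom Y Y') d = 0.
Proof.
have := push_linm (extri_bifunctor E) 1 (0 : hom Y Y') 0 d.
by rewrite !scale1r addr0 => /esym/(canRL (addrK _)); rewrite subrr.
Qed.

Lemma push1 X Y (d : Ext X Y) : push (idm Y) d = d.
Proof. exact: push_id (extri_bifunctor E) _ _ d. Qed.

Lemma pushM X Y Y' Y'' (a' : hom Y' Y'') (a : hom Y Y') (d : Ext X Y) :
  push (a' ∘ a) d = push a' (push a d).
Proof. exact: push_comp (extri_bifunctor E) _ _ _ _ a' a d. Qed.

Lemma push_pullC X' X Y Y' (a : hom Y Y') (c : hom X' X) (d : Ext X Y) :
  push a (pull c d) = pull c (push a d).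
Proof. exact: push_pull (extri_bifunctor E) _ _ _ _ a c d. Qed.

Lemma pullDl X' X Y (c c' : hom X' X) (d : Ext X Y) :
  pull (c + c') d = pull c d + pull c' d.
Proof.
by have := pull_linm (extri_bifunctor E) 1 c c' d; rewrite !scale1r.
Qed.

Lemma pullBl X' X Y (c c' : hom X' X) (d : Ext X Y) :
  pull (c - c') d = pull c d - pull c' d.
Proof.
rewrite [c - c']addrC -[- c']scaleN1r (pull_linm (extri_bifunctor E)) scaleN1r.
by rewrite addrC.
Qed.

End Exactness.

Section ExactnessPull.
Local Open Scope ring_scope.
Context {k : fieldType} {E : extriCat k}.
Implicit Types X Y Z W : E.

Lemma pull0 X' X Y (c : hom X' X) : pull c (0 : Ext X Y) = 0.
Proof. exact: (@push0 k (op E)). Qed.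

Lemma pull0l X' X Y (d : Ext X Y) : pull (0 : hom X' X) d = 0.
Proof. exact: (@push0l k (op E)). Qed.

Lemma pull1 X Y (d : Ext X Y) : pull (idm X) d = d.
Proof. exact: (@push1 k (op E)). Qed.

Lemma pullM X'' X' X Y (c : hom X' X) (c' : hom X'' X') (d : Ext X Y) :
  pull (c ∘ c') d = pull c' (pull c d).
Proof. exact: (@pushM k (op E)). Qed.

Lemma ex_zero : exists O : E, is_zero O.
Proof. by case: (extri_additive E). Qed.

(** This trivial triangle and its dual serve as test objects: comparing them with a given triangle
    yields the exact sequences below. *)
Lemma realizes_idl X O : is_zero O -> realizes (0 : Ext O X) (idm X) (0 : hom X O).
Proof.
move=> O0; exact: realizes_split (extri_additive_realization E) _ _ _ _ _ _ _
  (biprod_zero _ O0).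
Qed.

End ExactnessPull.

Section HomExact.
Local Open Scope ring_scope.
Context {k : fieldType} {E : extriCat k}.
Implicit Types X Y Z W : E.

Lemma realizes_idr X O : is_zero O -> realizes (0 : Ext X O) (0 : hom O X) (idm X).
Proof. by case=> O1 O2; apply: (@realizes_idl k (op E)). Qed.

Section Triangle.
Context {X Y Z : E} {d : Ext Z X} {x : hom X Y} {y : hom Y Z}.
Hypothesis r : realizes d x y.

Lemma realizes_comp0 : y ∘ x = 0.
Proof.
have [O O0] := @ex_zero k E.
(* ET3 maps the trivial triangle on [X] to the given one by [idm X] and [x]; the third map starts at
   the zero object, so [y ∘ x] factors through it. *)
have e : x ∘ idm X = x ∘ idm X by [].
have [c [<- _]] := extri_ET3 (realizes_idl X O0) r e.
by rewrite comp0r.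
Qed.

Lemma realizes_push0 : push x d = 0.
Proof.
have [O O0] := @ex_zero k E.
have e : idm Y ∘ x = idm Y ∘ x by [].
have [c [_ ->]] := extri_ET3 r (realizes_idl Y O0) e.
by rewrite pull0.
Qed.

Lemma hom_exact_mid W (f : hom W Y) : y ∘ f = 0 -> exists g, f = x ∘ g.
Proof.
move=> yf; have [O O0] := @ex_zero k E.
have e : (0 : hom O Z) ∘ (0 : hom W O) = y ∘ f by rewrite yf comp0l.
have [a [fa _]] := extri_ET3op (realizes_idl W O0) r e.
by exists a; rewrite -fa comp_idr.
Qed.

Lemma hom_exact_right W (f : hom W Z) : pull f d = 0 -> exists g, f = y ∘ g.
Proof.
move=> fd; have [O O0] := @ex_zero k E.
have e : push (0 : hom O X) (0 : Ext W O) = pull f d by rewrite fd push0.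
have [b [_ yb]] := realizes_mor (extri_realization E) (realizes_idr W O0) r e.
by exists b; rewrite yb comp_idr.
Qed.

End Triangle.
End HomExact.

Section CohomExact.
Local Open Scope ring_scope.
Context {k : fieldType} {E : extriCat k} {X Y Z : E} {d : Ext Z X} {x : hom X Y}
  {y : hom Y Z}.
Hypothesis r : realizes d x y.

Lemma realizes_pull0 : pull y d = 0.
Proof. exact: (@realizes_push0 k (op E) _ _ _ _ _ _ r). Qed.

Lemma cohom_exact_right W (f : hom X W) : push f d = 0 -> exists g, f = g ∘ x.
Proof. exact: (@hom_exact_right k (op E) _ _ _ _ _ _ r). Qed.

End CohomExact.

Section ExtExact.
Local Open Scope ring_scope.
Context {k : fieldType} {E : extriCat k} {X Y Z : E} {d : Ext Z X} {x : hom X Y}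
  {y : hom Y Z}.
Hypothesis r : realizes d x y.

(** Realize [e] by M: as [push x e] = 0, the map [x] extends over M, and ET3 completes this to a map
    of triangles whose third component is [f]. *)
Lemma ext_exact_left W (e : Ext W X) :
  push x e = 0 -> exists f : hom W Z, e = pull f d.
Proof.
move=> xe; have [M [m [p rM]]] := realizes_ex (extri_realization E) e.
have [g xg] := cohom_exact_right rM xe.
have eq : g ∘ m = x ∘ idm X by rewrite comp_idr.
have [c [_ ec]] := extri_ET3 rM r eq.
by exists c; rewrite -ec push1.
Qed.

(** ET4 for [x] and the inflation realizing [e] yields a triangle Z → G → W realizing [push y e] =
    0. Its deflation has a section [s], along which the extension [d3] of the composite pulls back
    to the preimage. *)
Lemma ext_exact_mid W (e : Ext W Y) :
  push y e = 0 -> exists e' : Ext W X, e = push x e'.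
Proof.
move=> ye; have [M [m [p rM]]] := realizes_ex (extri_realization E) e.
have [G [u [v [h [d3 [_ _ _ rG [_ xd3]]]]]]] := extri_ET4 r rM.
have vd : pull (idm W) (push y e) = 0 by rewrite ye pull0.
have [s vs] := hom_exact_right rG vd.
by exists (pull s d3); rewrite push_pullC xd3 -pullM -vs pull1.
Qed.

End ExtExact.

Section ExtExactRight.
Local Open Scope ring_scope.
Context {k : fieldType} {E : extriCat k} {X Y Z : E} {d : Ext Z X} {x : hom X Y}
  {y : hom Y Z}.
Hypothesis r : realizes d x y.

Lemma coext_exact_left W (e : Ext Z W) :
  pull y e = 0 -> exists f : hom X W, e = push f d.
Proof. exact: (@ext_exact_left k (op E) _ _ _ _ _ _ r). Qed.

Lemma realizes_section (s : hom Z Y) : y ∘ s = idm Z -> d = 0.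
Proof. by move=> ys; rewrite -(pull1 d) -ys pullM (realizes_pull0 r) pull0. Qed.

Lemma realizes_retraction (s : hom Y X) : s ∘ x = idm X -> d = 0.
Proof.
by move=> ys; rewrite -(push1 d) -ys pushM (realizes_push0 r) push0.
Qed.

End ExtExactRight.

(** * Five lemmas for morphisms of triangles *)

Section FiveLemma.
Local Open Scope ring_scope.
Context {k : fieldType}.

(** Lifting [c' ∘ y'] through [y] gives a section of [b] up to the image of [x'], and [h] corrects
    it. A retraction of [b] is then this same lemma in [op E]. *)
Lemma five_middle_section (E : extriCat k) (X Y Z X' Y' Z' : E)
    (d : Ext Z X) (d' : Ext Z' X') (x : hom X Y) (y : hom Y Z)
    (x' : hom X' Y') (y' : hom Y' Z') (a : hom X X') (b : hom Y Y')
    (c : hom Z Z') :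
  realizes d x y -> realizes d' x' y' -> b ∘ x = x' ∘ a -> y' ∘ b = c ∘ y ->
  push a d = pull c d' -> is_iso a -> is_iso c ->
  exists s, b ∘ s = idm Y'.
Proof.
move=> r r' bx yb ad [a' [a'a aa']] [c' [c'c cc']].
have dy : pull (c' ∘ y') d = 0.
  rewrite -(push1 (pull _ _)) -a'a pushM push_pullC ad -pullM comp_assoc cc'.
  by rewrite comp_idl (realizes_pull0 r') push0.
have [g yg] := hom_exact_right r dy.
have ybg : y' ∘ (idm Y' - b ∘ g) = 0.
  by rewrite compBr comp_idr comp_assoc yb -comp_assoc -yg comp_assoc cc'
    comp_idl subrr.
have [h eh] := hom_exact_mid r' ybg.
exists (g + x ∘ a' ∘ h).
rewrite compDr -!comp_assoc (comp_assoc b x) bx -(comp_assoc x') (comp_assoc a).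
by rewrite aa' comp_idl -eh addrC subrK.
Qed.

Lemma five_middle (E : extriCat k) (X Y Z X' Y' Z' : E)
    (d : Ext Z X) (d' : Ext Z' X') (x : hom X Y) (y : hom Y Z)
    (x' : hom X' Y') (y' : hom Y' Z') (a : hom X X') (b : hom Y Y')
    (c : hom Z Z') :
  realizes d x y -> realizes d' x' y' -> b ∘ x = x' ∘ a -> y' ∘ b = c ∘ y ->
  push a d = pull c d' -> is_iso a -> is_iso c -> is_iso b.
Proof.
move=> r r' bx yb ad ai ci.
have [s bs] := five_middle_section r r' bx yb ad ai ci.
have [t tb] := @five_middle_section (op E) _ _ _ _ _ _ _ _ _ _ _ _ _ _ _
  r' r yb bx (esym ad) (proj2 (op_iso c) ci) (proj2 (op_iso a) ai).
exact: (@left_right_inv_iso k E Y Y' b t s tb bs).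
Qed.

(** The map [g] is a section of [c] up to the image of [y'], and [h] corrects it; since [c] is also
    monic, the section is a two-sided inverse. *)
Lemma five_right (E : extriCat k) (X Y Z X' Y' Z' : E)
    (d : Ext Z X) (d' : Ext Z' X') (x : hom X Y) (y : hom Y Z)
    (x' : hom X' Y') (y' : hom Y' Z') (a : hom X X') (b : hom Y Y')
    (c : hom Z Z') :
  realizes d x y -> realizes d' x' y' -> b ∘ x = x' ∘ a -> c ∘ y = y' ∘ b ->
  push a d = pull c d' -> is_iso a -> is_iso b -> is_iso c.
Proof.
move=> r r' bx cy ad [a' [a'a aa']] [b' [b'b bb']].
have xa : x ∘ a' = b' ∘ x'.
  by rewrite -[x](comp_idl) -b'b -!comp_assoc (comp_assoc b) bx -comp_assoc aa'
    comp_idr.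
have ex : push x (push a' d') = 0.
  by rewrite -pushM xa pushM (realizes_push0 r') push0.
have [g eg] := ext_exact_left r ex.
have e : pull (idm Z' - c ∘ g) d' = 0.
  rewrite pullBl pull1 pullM -ad -push_pullC -eg -pushM aa' push1 subrr //.
have [h eh] := hom_exact_right r' e.
have cs : c ∘ (g + y ∘ b' ∘ h) = idm Z'.
  rewrite compDr -!comp_assoc (comp_assoc c) cy -(comp_assoc y') (comp_assoc b).
  by rewrite bb' comp_idl -eh addrC subrK.
move: (g + _) cs => s cs.
have c_mono W (f : hom W Z) : c ∘ f = 0 -> f = 0.
  move=> cf; have fd : pull f d = 0.
    by rewrite -(push1 (pull _ _)) -a'a pushM push_pullC ad -pullM cf pull0l push0.
  have [l fl] := hom_exact_right r fd.
  have ybl : y' ∘ (b ∘ l) = 0 by rewrite comp_assoc -cy -comp_assoc -fl.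
  have [m em] := hom_exact_mid r' ybl.
  rewrite fl -[l]comp_idl -b'b -comp_assoc em (comp_assoc b') -xa -!comp_assoc.
  by rewrite comp_assoc (realizes_comp0 r) comp0l.
apply: (@left_right_inv_iso _ _ _ _ c s s) => //.
apply/eqP; rewrite -subr_eq0; apply/eqP/c_mono.
by rewrite compBr comp_assoc cs comp_idl comp_idr subrr.
Qed.

End FiveLemma.

(** * Triangles recorded by their objects alone: splittings and octahedra *)

Definition tri (k : fieldType) (E : extriCat k) (X Y Z : E) : Prop :=
  exists (x : hom X Y) (y : hom Y Z), Etriangle x y.

Definition van (k : fieldType) (E : extriCat k) (X Y : E) : Prop :=
  forall d : Ext X Y, d = 0%R.

Section Triangles.
Local Open Scope ring_scope.
Context {k : fieldType} {E : extriCat k}.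
Implicit Types X Y Z W : E.

Lemma realizes_tri X Y Z (d : Ext Z X) (x : hom X Y) (y : hom Y Z) :
  realizes d x y -> tri X Y Z.
Proof. by move=> r; exists x, y, d. Qed.

(** The candidate extension is [pull c' d] with [c'] inverse to [c]; the five lemma identifies its
    realization with the given sequence. *)
Lemma Etriangle_iso_right X Y Z Z' (x : hom X Y) (y : hom Y Z) (c : hom Z Z') :
  Etriangle x y -> is_iso c -> Etriangle x (c ∘ y).
Proof.
case=> d r ci; have [c' [c'c cc']] := ci; exists (pull c' d).
have [Y' [x' [y' r']]] := realizes_ex (extri_realization E) (pull c' d).
have e : push (idm X) d = pull c (pull c' d) by rewrite push1 -pullM c'c pull1.
have [b [bx yb]] := realizes_mor (extri_realization E) r r' e.
have bi : is_iso b by apply: five_middle r r' bx yb e (is_iso_id X) ci.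
have /is_iso_inv[b' b'i [b'b bb']] := bi.
apply/(realizes_equiv (extri_realization E) _ _ r'); exists b'; split=> //.
  by rewrite -[x']comp_idr -bx comp_assoc b'b comp_idl.
by rewrite -yb -comp_assoc bb' comp_idr.
Qed.

Lemma tri_iso_right X Y Z Z' : tri X Y Z -> isomorphic Z Z' -> tri X Y Z'.
Proof.
by case=> x [y t] [c ci]; exists x, (c ∘ y); apply: Etriangle_iso_right.
Qed.

Lemma realizes_zero_right X Y Z (d : Ext Z X) (x : hom X Y) (y : hom Y Z) :
  realizes d x y -> is_zero Z -> is_iso x.
Proof.
move=> r Z0; have d0 : push (idm X) d = 0.
  by rewrite push1 -(pull1 d) (zero_id0 Z0) pull0l.
have [s es] := cohom_exact_right r d0.
have yi : y ∘ idm Y = 0 by apply: Z0.2.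
have [t et] := hom_exact_mid r yi.
exact: left_right_inv_iso (esym es) (esym et).
Qed.

Lemma realizes_iso_zero_right X Y Z (d : Ext Z X) (x : hom X Y) (y : hom Y Z) :
  realizes d x y -> is_iso x -> is_zero Z.
Proof.
move=> r [s [sx xs]].
have d0 : pull (idm Z) d = 0 by rewrite (realizes_retraction r sx) pull0.
have [t et] := hom_exact_right r d0.
apply: id0_zero; rewrite et -[y]comp_idr -xs comp_assoc (realizes_comp0 r).
by rewrite !comp0l.
Qed.

Lemma realizes0_biprod X Y Z (x : hom X Y) (y : hom Y Z) :
  realizes (0 : Ext Z X) x y -> biprod X Z Y.
Proof.
move=> r; have [S [i1 [i2 [p1 [p2 bp]]]]] := (extri_additive E).2 X Z.
have /(realizes_equiv (extri_realization E) _ _) r' :=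
  realizes_split (extri_additive_realization E) bp.
have /r'[b [[b' [b'b bb']] bx yb]] := r.
case: bp => h1 h2 h3 h4 h5.
exists (b' ∘ i1), (b' ∘ i2), (p1 ∘ b), (p2 ∘ b); split;
  rewrite -!comp_assoc ?(comp_assoc b b') ?bb' ?comp_idl //.
by rewrite -compDr !comp_assoc -compDl h5 comp_idl.
Qed.

Lemma tri_split X Y Z : van Z X -> tri X Y Z -> biprod X Z Y.
Proof.
by move=> v [x [y [d r]]]; move: r; rewrite (v d); apply: realizes0_biprod.
Qed.

Lemma van_tri X Z W Y : van W X -> van W Z -> tri X Y Z -> van W Y.
Proof.
move=> vX vZ [x [y [d r]]] e.
have [e' ->] := ext_exact_mid r (vZ (push y e)).
by rewrite (vX e') push0.
Qed.

Lemma van_isol X X' Y : isomorphic X X' -> van X Y -> van X' Y.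
Proof.
case=> f [g [gf fg]] v e; rewrite -(pull1 e) -fg pullM.
by rewrite (v (pull f e)) pull0.
Qed.

Lemma van_zerol X Y : is_zero X -> van X Y.
Proof. by move=> /zero_id0 X0 e; rewrite -(pull1 e) X0 pull0l. Qed.

Lemma van_zeror X Y : is_zero Y -> van X Y.
Proof. by move=> /zero_id0 Y0 e; rewrite -(push1 e) Y0 push0l. Qed.

Lemma projectiveP (P : E) : projective P <-> forall Y, van P Y.
Proof.
split=> [pP Y d | v X Y Z x y [d r] c]; last first.
  by have [b ->] := hom_exact_right r (v _ (pull c d)); exists b.
have [M [x [y r]]] := realizes_ex (extri_realization E) d.
have [s ys] := pP _ _ _ x y (ex_intro _ d r) (idm P).
exact (realizes_section r ys).
Qed.

Lemma tri_ET4 (A B C D F : E) : tri A B D -> tri B C F ->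
  exists G, tri A C G /\ tri D G F.
Proof.
case=> f [f' [d1 r1]] [g [g' [d2 r2]]].
have [G [d [e [h [d3 [r3 _ _ r4 _]]]]]] := extri_ET4 r1 r2.
by exists G; split; [apply: realizes_tri r3 | apply: realizes_tri r4].
Qed.

(* M realizes the sum of the two extensions in E(C, A1 (+) A2); composing its
   inflation with the inclusion of one summand leaves the other extension. *)
Lemma tri_common_end (A1 B1 A2 B2 C : E) : tri A1 B1 C -> tri A2 B2 C ->
  exists M, tri A2 M B1 /\ tri A1 M B2.
Proof.
case=> x1 [y1 [d1 r1]] [x2 [y2 [d2 r2]]].
have [S [i1 [i2 [p1 [p2 bp]]]]] := (extri_additive E).2 A1 A2.
pose m := push i1 d1 + push i2 d2.
have [M [f [g r]]] := realizes_ex (extri_realization E) m.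
have half (A A' B : E) (i : hom A S) (i' : hom A' S) (p : hom S A)
    (p' : hom S A') (d : Ext C A) (x : hom A B) (y : hom B C) :
    is_biprod i i' p p' -> realizes d x y -> push p m = d -> tri A' M B.
  move=> /biprod_sym b rd pm.
  have [G [u [v [h [d3 [r3 _ _ r4 _]]]]]] :=
    extri_ET4 (realizes_split (extri_additive_realization E) b) r.
  rewrite pm in r4; have /(realizes_equiv (extri_realization E) _ _ r4) := rd.
  by case=> c [ci _ _]; apply: tri_iso_right (realizes_tri r3) _; exists c.
case: (bp) => h1 h2 h3 h4 _; exists M; split.
  by apply: half bp r1 _; rewrite /m pushD -!pushM h1 h4 push1 push0l addr0.
apply: half (biprod_sym bp) r2 _.
by rewrite /m pushD -!pushM h2 h3 push1 push0l add0r.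
Qed.

End Triangles.

Section OppositeTriangles.
Local Open Scope ring_scope.
Context {k : fieldType} {E : extriCat k}.
Implicit Types X Y Z W : E.

Lemma op_tri X Y Z : @tri k (op E) Z Y X <-> tri X Y Z.
Proof. by split=> -[x [y t]]; exists y, x. Qed.

Lemma op_zero X : @is_zero k (op E) X <-> is_zero X.
Proof. by split=> -[]. Qed.

Lemma op_isomorphic X Y : @isomorphic k (op E) X Y <-> isomorphic X Y.
Proof.
split=> [[f /op_iso fi] | [f fi]]; first by apply: isomorphic_sym; exists f.
by have [g gi _] := is_iso_inv fi; exists g; apply/op_iso.
Qed.

Lemma op_biprodE X Y S : @biprod k (op E) X Y S <-> biprod X Y S.
Proof.
split=> -[i1 [i2 [p1 [p2 b]]]]; exists p1, p2, i1, i2.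
  exact: op_biprodV b.
exact: op_biprod b.
Qed.

Lemma op_subcat (D : E -> Prop) : @is_subcat k (op E) D <-> is_subcat D.
Proof.
split=> -[h1 h2 h3 h4]; split=> [X Y /op_isomorphic|X /op_zero|X Y S|X Y S];
  by [apply: h1 | apply: h2 | move/op_biprodE; apply: h3
     | move/op_biprodE; apply: h4].
Qed.

Lemma Etriangle_iso_left X' X Y Z (x : hom X Y) (y : hom Y Z) (a : hom X' X) :
  Etriangle x y -> is_iso a -> Etriangle (x ∘ a) y.
Proof.
by move=> t /op_iso; apply: (@Etriangle_iso_right k (op E) _ _ _ _ y x a t).
Qed.

Lemma realizes_zero_left X Y Z (d : Ext Z X) (x : hom X Y) (y : hom Y Z) :
  realizes d x y -> is_zero X -> is_iso y.
Proof.
move=> r /op_zero X0; apply/op_iso.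
exact: (@realizes_zero_right k (op E) _ _ _ _ _ _ r X0).
Qed.

Lemma van_cotri X Z W Y : van X W -> van Z W -> tri X Y Z -> van Y W.
Proof.
move=> vX vZ /op_tri t; exact: (@van_tri k (op E) _ _ _ _ vZ vX t).
Qed.

Lemma op_projective X : @projective k (op E) X <-> injective_obj X.
Proof. by split=> H U V W u v t c; have := H _ _ _ v u t c. Qed.

Lemma op_injective X : @injective_obj k (op E) X <-> projective X.
Proof. by split=> H U V W u v t c; have := H _ _ _ v u t c. Qed.

Lemma injectiveP (I : E) : injective_obj I <-> forall X, van X I.
Proof.
split=> [/op_projective/(@projectiveP k (op E)) //|h].
by apply/op_projective/(@projectiveP k (op E)).
Qed.

Lemma tri_common_start (A B1 C1 B2 C2 : E) : tri A B1 C1 -> tri A B2 C2 ->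
  exists M, tri B1 M C2 /\ tri B2 M C1.
Proof.
move=> /op_tri t1 /op_tri t2.
have [M [/op_tri m1 /op_tri m2]] := @tri_common_end k (op E) _ _ _ _ _ t1 t2.
by exists M.
Qed.

Lemma tri_zero_left X Y Z : is_zero X -> tri X Y Z -> isomorphic Y Z.
Proof. by move=> X0 [x [y [d r]]]; exists y; apply: realizes_zero_left r X0. Qed.

Lemma tri_zero_right X Y Z : is_zero Z -> tri X Y Z -> isomorphic X Y.
Proof. by move=> Z0 [x [y [d r]]]; exists x; apply: realizes_zero_right r Z0. Qed.

Lemma tri_zero_zero X Y Z : is_zero X -> is_zero Y -> tri X Y Z -> is_zero Z.
Proof. by move=> X0 Y0 /(tri_zero_left X0) yz; apply: isomorphic_zero yz Y0. Qed.

Lemma op_enough_projectives : enough_projectives (op E) <-> enough_injectives E.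
Proof.
split=> h X; have [I [Z [x [y [t p]]]]] := h X; exists Z, I, y, x; split=> //;
  by apply/op_projective.
Qed.

Lemma op_enough_injectives : enough_injectives (op E) <-> enough_projectives E.
Proof.
split=> h X; have [I [Z [x [y [t p]]]]] := h X; exists Z, I, y, x; split=> //;
  by apply/op_injective.
Qed.

End OppositeTriangles.

(** * Dimension shifting and higher extensions *)

Section DimensionShift.
Local Open Scope ring_scope.
Context {k : fieldType}.

(** In [op E] this reads as a cosyzygy: SY is one of Y when Y → I → SY is a triangle with I
    injective. *)
Definition is_syz (E : extriCat k) (X Z : E) : Prop :=
  exists2 P, projective P & tri Z P X.

(** An extension of OX by Y is pulled back from a map OX → SY. This map extends over P because E(X,
    SY) = 0, and then lifts to I, where the extension dies. *)
Lemma van_shift (E : extriCat k) (X Y OX SY : E) :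
  is_syz X OX -> @is_syz (op E) Y SY -> van X SY -> van OX Y.
Proof.
case=> P pP [u [p [dX rX]]] [I /op_projective/injectiveP iI] /op_tri[q [s [dY rY]]] v e.
have [h eh] := ext_exact_left rY (iI _ (push q e)).
have [g hg] := cohom_exact_right rX (v (push h dX)).
have [l gl] := pP _ _ _ _ _ (ex_intro _ dY rY) g.
by rewrite eh hg -gl -comp_assoc pullM (realizes_pull0 rY) pull0.
Qed.

Lemma van_shiftE (E : extriCat k) (X Y OX SY : E) :
  is_syz X OX -> @is_syz (op E) Y SY -> van OX Y <-> van X SY.
Proof.
move=> sX sY; split; last exact: van_shift.
move=> v; apply: (@van_shift (op E) Y X SY OX sY _ v).
case: sX => P pP t; exists P; last by apply/op_tri/op_tri.
by apply/op_projective/op_injective.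
Qed.

Lemma syzygy1 (E : extriCat k) (X Z : E) : syzygy 1 X Z <-> is_syz X Z.
Proof.
split=> [[Y [P [x [y [/= e pP t]]]]] | [P pP [x [y t]]]].
  subst Y.
  by exists P => //; exists x, y.
by exists X, P, x, y.
Qed.

Lemma syzygyS (E : extriCat k) i (X Z : E) :
  syzygy i.+1 X Z <-> exists2 Y, syzygy i X Y & is_syz Y Z.
Proof.
split=> [[Y [P [x [y [sY pP t]]]]] | [Y sY [P pP [x [y t]]]]].
  by exists Y => //; exists P => //; exists x, y.
by exists Y, P, x, y.
Qed.

Lemma syzygySl (E : extriCat k) i (X Z : E) :
  syzygy i.+1 X Z <-> exists2 Y, is_syz X Y & syzygy i Y Z.
Proof.
elim: i Z => [|i IH] Z.
  by rewrite syzygy1; split=> [|[Y XY /= ->]] //; exists Z.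
split=> [/syzygyS[Y /IH[W XW WY] YZ] | [W XW /syzygyS[Y WY YZ]]].
  by exists W => //; apply/syzygyS; exists Y.
by apply/syzygyS; exists Y => //; apply/IH; exists W.
Qed.

Lemma syzygy_ex (E : extriCat k) i (X : E) :
  enough_projectives E -> exists Z, syzygy i X Z.
Proof.
move=> eP; elim: i => [|i [Y sY]]; first by exists X.
have [Z [P [x [y [t pP]]]]] := eP Y.
by exists Z; apply/syzygyS; exists Y => //; exists P => //; exists x, y.
Qed.

Lemma cosyzygy_ex (E : extriCat k) i (Y : E) :
  enough_injectives E -> exists W : E, @syzygy k (op E) i Y W.
Proof. by move/op_enough_projectives; apply: syzygy_ex. Qed.

(** Each step of the induction trades the last syzygy of [X] for the first cosyzygy of [Y]. *)
Lemma van_balance (E : extriCat k) i (X Y Z W : E) :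
  syzygy i X Z -> @syzygy k (op E) i Y W -> van Z Y <-> van X W.
Proof.
elim: i Y Z => [|i IH] Y Z; first by move=> /= -> ->.
move=> /syzygyS[X' XX' X'Z] /syzygySl[Y' YY' Y'W].
by rewrite (van_shiftE X'Z YY'); apply: IH.
Qed.

End DimensionShift.

Section HigherExt.
Local Open Scope ring_scope.
Context {k : fieldType} {E : extriCat k}.
Hypotheses (eP : enough_projectives E) (eI : enough_injectives E).
Implicit Types X Y Z W : E.

Lemma ext_vanish1 X Y : ext_vanish 1 X Y <-> van X Y.
Proof. by split=> [v|v Z /= ->]; [apply: v|]. Qed.

(** [ext_vanish] quantifies over all syzygies; one suffices, since any two are compared through a
    common cosyzygy of [Y]. *)
Lemma ext_vanish_syz i X Y Z :
  syzygy i X Z -> van Z Y <-> ext_vanish i.+1 X Y.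
Proof.
move=> XZ; split=> [v Z' XZ'|]; last by move/(_ Z XZ).
have [W YW] : exists W, @syzygy k (op E) i Y W.
  exact: cosyzygy_ex.
by apply/(van_balance XZ' YW)/(van_balance XZ YW).
Qed.

Lemma ext_vanish_cosyz i X Y W :
  @syzygy k (op E) i Y W -> van X W <-> ext_vanish i.+1 X Y.
Proof.
move=> YW; have [Z XZ] := syzygy_ex i X eP.
by rewrite -(van_balance XZ YW); apply: ext_vanish_syz.
Qed.

Lemma ext_vanish2_syz i X Y Z :
  syzygy i X Z -> ext_vanish 2 Z Y <-> ext_vanish i.+2 X Y.
Proof.
move=> XZ; have [W ZW] := syzygy_ex 1 Z eP.
rewrite -(ext_vanish_syz Y ZW); apply: ext_vanish_syz.
by apply/syzygyS; exists Z => //; apply/syzygy1.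
Qed.

Lemma ext_vanish_tri_mid i W X Y Z : tri X Y Z ->
  ext_vanish i.+1 W X -> ext_vanish i.+1 W Z -> ext_vanish i.+1 W Y.
Proof.
move=> t; have [W' WW'] := syzygy_ex i W eP.
by rewrite -!(ext_vanish_syz _ WW') => vX vZ; apply: van_tri t.
Qed.

(** Exactness of E^{i+1}(W,Y) → E^{i+1}(W,Z) → E^{i+2}(W,X). A syzygy W' reduces to i = 0; there a
    class is the push of a map from the next syzygy O to Z, which lifts to Y because E(O, X) = 0. *)
Lemma ext_vanish_tri_right i W X Y Z : tri X Y Z ->
  ext_vanish i.+1 W Y -> ext_vanish i.+2 W X -> ext_vanish i.+1 W Z.
Proof.
move=> [x [y [d r]]]; have [W' WW'] := syzygy_ex i W eP.
rewrite -!(ext_vanish_syz _ WW') -(ext_vanish2_syz _ WW').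
have [O [P [u [p [[dW rW] pP]]]]] := eP W'.
have WO : syzygy 1 W' O.
  by apply/syzygy1; exists P => //; apply: realizes_tri rW.
rewrite -(ext_vanish_syz _ WO) => vY vX e.
have /projectiveP vP := pP.
have [h ->] := coext_exact_left rW (vP _ (pull p e)).
have [g ->] := hom_exact_right r (vX (pull h d)).
by rewrite pushM (vY (push g dW)) push0.
Qed.

Lemma ext_vanish_tri_left i W X Y Z : tri X Y Z ->
  ext_vanish i.+1 W Z -> ext_vanish i.+2 W Y -> ext_vanish i.+2 W X.
Proof.
move=> [x [y [d r]]]; have [W' WW'] := syzygy_ex i W eP.
rewrite -!(ext_vanish_syz _ WW') -!(ext_vanish2_syz _ WW').
have [O [P [u [p [[dW rW] pP]]]]] := eP W'.
have WO : syzygy 1 W' O.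
  by apply/syzygy1; exists P => //; apply: realizes_tri rW.
rewrite -!(ext_vanish_syz _ WO) => vZ vY e.
have /projectiveP vP := pP.
have [f ->] := ext_exact_left r (vY (push x e)).
have [g ->] := cohom_exact_right rW (vZ (push f dW)).
by rewrite pullM (vP _ (pull g d)) pull0.
Qed.

Lemma ext_vanish_projective i P Y : projective P -> ext_vanish i.+1 P Y.
Proof.
have [W YW] : exists W, @syzygy k (op E) i Y W.
  exact: cosyzygy_ex.
by move/projectiveP => vP; rewrite -(ext_vanish_cosyz P YW); apply: vP.
Qed.

(** Syzygies on the left and cosyzygies on the right detect the same vanishing, so the contravariant
    exact sequences follow from the covariant ones. *)
Lemma op_ext_vanish i X Y : @ext_vanish k (op E) i.+1 Y X <-> ext_vanish i.+1 X Y.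
Proof.
split=> [v|v W YW]; last exact: (proj2 (ext_vanish_cosyz X YW) v).
have [W YW] : exists W, @syzygy k (op E) i Y W.
  exact: cosyzygy_ex.
by apply/(ext_vanish_cosyz X YW); apply: v.
Qed.

End HigherExt.

Section HigherExtOp.
Context {k : fieldType} {E : extriCat k}.
Hypotheses (eP : enough_projectives E) (eI : enough_injectives E).
Implicit Types X Y Z W : E.

Let oP : enough_projectives (op E). Proof. exact/op_enough_projectives. Qed.
Let oI : enough_injectives (op E). Proof. exact/op_enough_injectives. Qed.

Lemma ext_vanish_cotri_mid i W X Y Z : tri X Y Z ->
  ext_vanish i.+1 X W -> ext_vanish i.+1 Z W -> ext_vanish i.+1 Y W.
Proof.
move=> /op_tri t /(op_ext_vanish eP eI) vX /(op_ext_vanish eP eI) vZ.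
apply/(op_ext_vanish eP eI).
exact: (ext_vanish_tri_mid oP oI t).
Qed.

Lemma ext_vanish_cotri_left i W X Y Z : tri X Y Z ->
  ext_vanish i.+1 Y W -> ext_vanish i.+2 Z W -> ext_vanish i.+1 X W.
Proof.
move=> /op_tri t /(op_ext_vanish eP eI) vY /(op_ext_vanish eP eI) vZ.
apply/(op_ext_vanish eP eI).
exact: (ext_vanish_tri_right oP oI t).
Qed.

Lemma ext_vanish_cotri_right i W X Y Z : tri X Y Z ->
  ext_vanish i.+1 X W -> ext_vanish i.+2 Y W -> ext_vanish i.+2 Z W.
Proof.
move=> /op_tri t /(op_ext_vanish eP eI) vX /(op_ext_vanish eP eI) vY.
apply/(op_ext_vanish eP eI).
exact: (ext_vanish_tri_left oP oI t).
Qed.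

Lemma ext_vanish_injective i X I : injective_obj I -> ext_vanish i.+1 X I.
Proof.
move/op_projective => iI; apply/(op_ext_vanish eP eI).
exact: (ext_vanish_projective oP oI).
Qed.

End HigherExtOp.

(** * Cotorsion pairs and heredity *)

Section CotorsionPairs.
Context {k : fieldType} {E : extriCat k}.
Implicit Types (X Y Z W : E) (D U V T : E -> Prop).

Lemma eq_subcat D D' : (forall X, D X <-> D' X) -> is_subcat D -> is_subcat D'.
Proof.
move=> e [h1 h2 h3 h4]; split.
- by move=> X Y i /e/(h1 _ _ i)/e.
- by move=> X /h2/e.
- by move=> X Y S b /e dX /e dY; apply/e/(h3 _ _ _ b).
- by move=> X Y S b /e/(h4 _ _ _ b)[/e dX /e dY].
Qed.

Lemma eq_wedge_n D D' n X :
  (forall X, D X <-> D' X) -> wedge_n D n X -> wedge_n D' n X.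
Proof.
move=> e; elim: n X => [|n IH] X; first by move/e.
by case=> Y [Z [x [y [t w /e d]]]]; exists Y, Z, x, y; split=> //; apply: IH.
Qed.

Lemma op_vee_n D n X : @vee_n k (op E) D n X <-> wedge_n D n X.
Proof.
elim: n X => [|n IH] X //; split=> -[Y [Z [x [y [t d w]]]]]; exists Z, Y, y, x;
  by split=> //; apply/IH.
Qed.

Lemma op_wedge_n D n X : @wedge_n k (op E) D n X <-> vee_n D n X.
Proof.
elim: n X => [|n IH] X //; split=> -[Y [Z [x [y [t w d]]]]]; exists Z, Y, y, x;
  by split=> //; apply/IH.
Qed.

Lemma eq_vee_n D D' n X :
  (forall X, D X <-> D' X) -> vee_n D n X -> vee_n D' n X.
Proof.
move=> e; elim: n X => [|n IH] X; first by move/e.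
by case=> Y [Z [x [y [t /e d w]]]]; exists Y, Z, x, y; split=> //; apply: IH.
Qed.

Lemma eq_n_tilting D D' n :
  (forall X, D X <-> D' X) -> n_tilting n D -> n_tilting n D'.
Proof.
move=> e [h1 h2 h3 h4]; split.
- exact: eq_subcat e h1.
- by move=> X /e/h2.
- by move=> i i_n X Y /e dX /e; apply: h3.
- by move=> P /h4; apply: eq_vee_n.
Qed.

Lemma eq_n_cotilting D D' n :
  (forall X, D X <-> D' X) -> n_cotilting n D -> n_cotilting n D'.
Proof.
move=> e [h1 h2 h3 h4]; split.
- exact: eq_subcat e h1.
- by move=> X /e/h2.
- by move=> i i_n X Y /e dX /e; apply: h3.
- by move=> P /h4; apply: eq_wedge_n.
Qed.

Lemma left_perp1_subcat D : is_subcat (left_perp1 D).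
Proof.
split=> [X Y i h W /h | X X0 W _ | X Y S b hX hY W DW | X Y S b hS].
- exact: van_isol.
- exact: van_zerol.
- move=> d; case: b => i1 [i2 [p1 [p2 [_ _ _ _ e]]]].
  rewrite -(pull1 d) -e pullDl !pullM.
  by rewrite (hX _ DW (pull i1 d)) (hY _ DW (pull i2 d)) !pull0 addr0.
- case: b => i1 [i2 [p1 [p2 [h1 h2 _ _ _]]]]; split=> W DW d.
    by rewrite -(pull1 d) -h1 pullM (hS _ DW (pull p1 d)) pull0.
  by rewrite -(pull1 d) -h2 pullM (hS _ DW (pull p2 d)) pull0.
Qed.

Lemma op_cotorsion U V : @cotorsion_pair k (op E) V U <-> cotorsion_pair U V.
Proof.
split=> -[h1 h2 h3 h4 h5]; split.
- exact: (proj1 (op_subcat _) h2).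
- exact: (proj1 (op_subcat _) h1).
- by move=> X Y hX hY d; apply: h3.
- by move=> B; have [X [Y [x [y [t v u]]]]] := h5 B; exists Y, X, y, x.
- by move=> B; have [X [Y [x [y [t v u]]]]] := h4 B; exists Y, X, y, x.
- exact: (proj2 (op_subcat _) h2).
- exact: (proj2 (op_subcat _) h1).
- by move=> X Y hX hY d; apply: h3.
- by move=> B; have [X [Y [x [y [t v u]]]]] := h5 B; exists Y, X, y, x.
- by move=> B; have [X [Y [x [y [t v u]]]]] := h4 B; exists Y, X, y, x.
Qed.

(** The envelope triangle of [Y] splits, so [Y] is a summand of an object of [V]. *)
Lemma cotorsion_memr U V Y :
  cotorsion_pair U V -> (forall X, U X -> van X Y) -> V Y.
Proof.
case=> h1 [_ _ _ h2] h3 h4 h5 vY.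
have [VY [UY [x [y [t v u]]]]] := h5 Y.
have b : biprod Y UY VY by apply: tri_split; [apply: vY | exists x, y].
by case: (h2 _ _ _ b v).
Qed.

End CotorsionPairs.

Section CotorsionClosure.
Context {k : fieldType} {E : extriCat k}.
Implicit Types (X Y Z W : E) (U V : E -> Prop).

Lemma cotorsion_meml U V X :
  cotorsion_pair U V -> (forall Y, V Y -> van X Y) -> U X.
Proof. by move/op_cotorsion => c v; apply: (cotorsion_memr c). Qed.

Lemma cotorsion_injective U V I : cotorsion_pair U V -> injective_obj I -> V I.
Proof. by move=> c /injectiveP vI; apply: cotorsion_memr c _ => X _. Qed.

Lemma cotorsion_closedr U V X Y Z :
  cotorsion_pair U V -> tri X Y Z -> V X -> V Z -> V Y.
Proof.
move=> c t vX vZ; apply: cotorsion_memr (c) _ => W uW.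
by apply: van_tri t => d; apply: (cotorsion_ext c).
Qed.

End CotorsionClosure.

Section Hereditary.
Context {k : fieldType} {E : extriCat k}.
Hypotheses (eP : enough_projectives E) (eI : enough_injectives E).
Implicit Types (X Y Z W : E) (U V T : E -> Prop).

Lemma op_hereditary U V :
  @hereditary_cotorsion_pair k (op E) V U <-> hereditary_cotorsion_pair U V.
Proof.
split=> -[/op_cotorsion c h]; split=> // X Y hX hY;
  by apply/(op_ext_vanish eP eI); apply: h.
Qed.

Lemma hereditary_cone U V X Y Z :
  hereditary_cotorsion_pair U V -> tri X Y Z -> V X -> V Y -> V Z.
Proof.
case=> c h t vX vY; apply: cotorsion_memr (c) _ => W uW; apply/ext_vanish1.
apply: (ext_vanish_tri_right eP eI t); last exact: h.
by apply/ext_vanish1 => d; apply: (cotorsion_ext c).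
Qed.

(** For Y in V embedded into an injective I, the cone of Y → I is again in V because I is; shifting
    the degree gives E^2(X, Y) = 0. *)
Lemma cone_closed_hereditary U V : cotorsion_pair U V ->
  (forall X Y Z, tri X Y Z -> V X -> V Y -> V Z) ->
  hereditary_cotorsion_pair U V.
Proof.
move=> c h; split=> // X Y uX vY; have [I [Z [x [y [t iI]]]]] := eI Y.
have tY : tri Y I Z by exists x, y.
apply: (ext_vanish_tri_left eP eI tY); last exact: (ext_vanish_injective eP eI).
apply/ext_vanish1 => d; apply: (cotorsion_ext c) => //.
exact: h tY vY (cotorsion_injective c iI).
Qed.

End Hereditary.

(** * Cotilting and tilting pairs through vanishing bounds *)

Section HereditaryExt.
Context {k : fieldType} {E : extriCat k}.
Hypotheses (eP : enough_projectives E) (eI : enough_injectives E).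
Implicit Types (X Y Z W : E) (U V T : E -> Prop).

Lemma hereditary_cocone U V X Y Z :
  hereditary_cotorsion_pair U V -> tri X Y Z -> U Y -> U Z -> U X.
Proof.
move=> /(op_hereditary eP eI) h /op_tri t uY uZ.
by apply: (hereditary_cone _ _ h t) => //;
  [apply/op_enough_projectives | apply/op_enough_injectives].
Qed.

Lemma cotorsion_projective U V P : cotorsion_pair U V -> projective P -> U P.
Proof. by move=> c /projectiveP vP; apply: cotorsion_meml c _ => X _. Qed.

(** Syzygies of [X] stay in [U], so every degree reduces to the first. *)
Lemma hereditary_ext U V i X Y :
  hereditary_cotorsion_pair U V -> U X -> V Y -> ext_vanish i.+1 X Y.
Proof.
move=> h uX vY; have [Z XZ] := syzygy_ex i X eP.
apply/(ext_vanish_syz eI _ XZ) => d; apply: (cotorsion_ext h.1) => // {d}.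
elim: i Z XZ => [Z /= -> //|i IH Z /syzygyS[W XW [P pP t]]].
exact: hereditary_cocone h t (cotorsion_projective h.1 pP) (IH _ XW).
Qed.

(** The degrees concerned are those strictly above n; the successor keeps them positive. *)
Definition vanishes_above (n : nat) X Y : Prop :=
  forall m, (n <= m)%N -> ext_vanish m.+1 X Y.

Lemma vee_injective_vanish n W X :
  vee_n injective_obj n X -> vanishes_above n W X.
Proof.
elim: n X => [|n IH] X.
  by move=> iX m _; apply: (ext_vanish_injective eP eI).
case=> I [Y [x [y [t iI /IH vY]]]] [|m] // nm.
have tX : tri X I Y by exists x, y.
apply: (ext_vanish_tri_left eP eI tX); first exact: vY.
exact: (ext_vanish_injective eP eI).
Qed.

Lemma vanish_vee_injective n X :
  (forall W, ext_vanish n.+1 W X) -> vee_n injective_obj n X.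
Proof.
elim: n X => [|n IH] X h.
  by apply/injectiveP => W; apply/ext_vanish1.
have [I [Z [x [y [t iI]]]]] := eI X; exists I, Z, x, y; split=> //.
have tX : tri X I Z by exists x, y.
apply: IH => W; apply: (ext_vanish_tri_right eP eI tX) => //.
exact: (ext_vanish_injective eP eI).
Qed.

(** Objects of [V] are iterated cones of objects of the core, whose injective dimension is at most
    n. E^j(X, Y) is squeezed between E^j(X, T) and E^{j+1}(X, Z), so cones do not enlarge the
    bound. *)
Lemma cotilting_vanish U V : cotilting_cotorsion_pair U V ->
  exists n, forall X Y, V Y -> vanishes_above n X Y.
Proof.
case=> _ [n _ [_ idT _ _]] wV _; exists n => X Y /wV[i].
elim: i Y => [|i IH] Y; first by move=> /idT /vee_injective_vanish.
case=> Z [T [x [y [t /IH vZ /idT/vee_injective_vanish vT]]]] m nm.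
have tY : tri Z T Y by exists x, y.
by apply: (ext_vanish_tri_right eP eI tY); [apply: vT | apply/vZ/leqW].
Qed.

(** In a cover V_Y → U_Y → Y the middle term lies in both classes, since [V] is closed under
    extensions, and V_Y satisfies the hypothesis one degree lower. In degree one, [Y] itself is in
    [U]. *)
Lemma core_wedge U V n Y : hereditary_cotorsion_pair U V -> V Y ->
  (forall W, V W -> ext_vanish n.+1 Y W) -> wedge_n (core U V) n Y.
Proof.
move=> h; have [c _] := h; elim: n Y => [|n IH] Y vY v.
  by split=> //; apply: cotorsion_meml (c) _ => W vW; apply/ext_vanish1/v.
have [VY [UY [x [y [t vV uU]]]]] := cotorsion_cover c Y.
have tY : tri VY UY Y by exists x, y.
have vU : V UY by apply: cotorsion_closedr c tY vV vY.
exists VY, UY, x, y; split=> //; apply: IH => // W vW.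
apply: (ext_vanish_cotri_left eP eI tY); last exact: v.
exact: hereditary_ext h uU vW.
Qed.

Lemma vanish_cotilting U V n : hereditary_cotorsion_pair U V ->
  (forall X Y, V Y -> vanishes_above n X Y) -> cotilting_cotorsion_pair U V.
Proof.
move=> h v; have [c _] := h.
(* A cotilting dimension is at least 1, so the bound is taken to be [n.+1]. *)
have v1 X Y (vY : V Y) : ext_vanish n.+2 X Y by apply: v (leqnSn n).
have wV Y : V Y <-> wedge (core U V) Y.
  split=> [vY | [i]].
    by exists n.+1; apply: core_wedge h vY _ => W; apply: v1.
  elim: i Y => [|i IH] Y; first by case.
  case=> Z [T [x [y [t /IH vZ [_ vT]]]]].
  by apply: (hereditary_cone eP eI h) vZ vT; exists x, y.
split=> //.
- exists n.+1 => //; split.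
  + have [[a1 a2 a3 a4] [b1 b2 b3 b4] _ _ _] := c; split.
    * by move=> X Y i [/(a1 _ _ i) u /(b1 _ _ i)].
    * by move=> X X0; split; [apply: a2 | apply: b2].
    * by move=> X Y S b [u w] [u' w']; split; [apply: a3 b u u' | apply: b3 b w w'].
    * by move=> X Y S b [/(a4 _ _ _ b)[u u'] /(b4 _ _ _ b)[w w']].
  + by move=> X [_ vX]; apply: vanish_vee_injective => W; apply: v1.
  + by case=> // i _ X Y [uX _] [_ vY]; apply: hereditary_ext h uX vY.
  + move=> I iI; apply: core_wedge h _ _ => [|W]; last exact: v1.
    exact: cotorsion_injective c iI.
- move=> X; split=> [uX [|i] // _ Y [_ vY]|pX].
    exact: hereditary_ext h uX vY.
  apply: cotorsion_meml c _ => Y /wV[j w]; apply/ext_vanish1.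
  (* The degree is generalized: each cone in the resolution of [Y] raises it by one. *)
  move: 0 => i; elim: j Y w i => [|j IH] Y; first by move=> T i; apply: pX.
  case=> Z [T [x [y [t /IH vZ cT]]]] i.
  have tY : tri Z T Y by exists x, y.
  by apply: (ext_vanish_tri_right eP eI tY); [apply: pX | apply: vZ].
Qed.

End HereditaryExt.

Section Tilting.
Context {k : fieldType} {E : extriCat k}.
Hypotheses (eP : enough_projectives E) (eI : enough_injectives E).
Implicit Types (X Y Z W : E) (U V T : E -> Prop).

Let oP : enough_projectives (op E). Proof. exact/op_enough_projectives. Qed.
Let oI : enough_injectives (op E). Proof. exact/op_enough_injectives. Qed.

Lemma op_n_cotilting n T : @n_cotilting k (op E) n T <-> n_tilting n T.
Proof.
split=> -[/op_subcat h1 h2 h3 h4]; split=> //.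
- move=> X /h2/op_vee_n; apply: eq_wedge_n => Y; exact: op_injective.
- case=> // i i_n X Y tX tY; apply/(op_ext_vanish eP eI); exact: h3 tY tX.
- by move=> P /op_injective/h4/op_wedge_n.
- move=> X /h2 w; apply/op_vee_n; apply: eq_wedge_n w => Y.
  by split=> /op_injective.
- case=> // i i_n X Y tX tY; apply/(op_ext_vanish eP eI); exact: h3 tY tX.
- by move=> P /op_injective/h4/op_wedge_n.
Qed.

(** Through this duality the vanishing criteria for tilting pairs are those for cotilting pairs in
    [op E]. *)
Lemma op_cotilting_cotorsion U V :
  @cotilting_cotorsion_pair k (op E) V U <-> tilting_cotorsion_pair U V.
Proof.
have eC X : @core k E U V X <-> @core k (op E) V U X by split=> -[].
have eC' X : @core k (op E) V U X <-> @core k E U V X by split=> -[].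
split=> -[h [n n1 tn] w p]; split.
- exact/(op_hereditary eP eI).
- by exists n => //; apply/op_n_cotilting; exact: (@eq_n_cotilting k (op E) _ _ n eC' tn).
- move=> X; rewrite w; split=> -[i v]; exists i.
    by apply: (eq_vee_n eC'); apply/op_wedge_n.
  by apply/op_wedge_n; apply: (eq_vee_n eC).
- move=> X; rewrite p; split=> q [|i] // _ Y /eC cY; apply/(op_ext_vanish eP eI);
    exact: q.
- exact/(op_hereditary eP eI).
- by exists n => //; apply/op_n_cotilting; apply: (eq_n_tilting eC tn).
- move=> X; rewrite w; split=> -[i v]; exists i.
    by apply/op_wedge_n; apply: (eq_vee_n eC).
  by apply: (eq_vee_n eC'); apply/op_wedge_n.
- move=> X; rewrite p; split=> q [|i] // _ Y /eC cY; apply/(op_ext_vanish eP eI);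
    exact: q.
Qed.

Lemma tilting_vanish U V : tilting_cotorsion_pair U V ->
  exists n, forall X Y, U X -> vanishes_above n X Y.
Proof.
move=> /op_cotilting_cotorsion/(cotilting_vanish oP oI)[n v]; exists n.
by move=> X Y uX m nm; apply/(op_ext_vanish eP eI); apply: v uX _ nm.
Qed.

Lemma vanish_tilting U V n : hereditary_cotorsion_pair U V ->
  (forall X Y, U X -> vanishes_above n X Y) -> tilting_cotorsion_pair U V.
Proof.
move=> /(op_hereditary eP eI) h v; apply/op_cotilting_cotorsion.
apply: (vanish_cotilting oP oI (n := n) h) => X Y uY m nm.
by apply/(op_ext_vanish eP eI); apply: v nm.
Qed.

Lemma wedge_projective_vanish n X Y :
  wedge_n projective n X -> vanishes_above n X Y.
Proof.
move=> w m nm; apply/(op_ext_vanish eP eI).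
apply: (vee_injective_vanish oP oI) nm; apply/op_vee_n.
by apply: eq_wedge_n w => Z; split=> /op_injective.
Qed.

End Tilting.

(** * Additive functors, adjunctions and their effect on extensions *)

Section AdditiveFunctors.
Local Open Scope ring_scope.
Context {k : fieldType} {E F : linCat k} (G : addFunctor E F).
Implicit Types X Y S : E.

Lemma fmor0 X Y : fmor G (0 : hom X Y) = 0.
Proof. by apply: (@addrI _ (fmor G 0)); rewrite -fmor_add !addr0. Qed.

Lemma fmor_iso X Y (f : hom X Y) : is_iso f -> is_iso (fmor G f).
Proof.
by case=> g [gf fg]; exists (fmor G g); rewrite -!fmor_comp gf fg !fmor_id.
Qed.

Lemma fmor_isomorphic X Y : isomorphic X Y -> isomorphic (G X) (G Y).
Proof. by case=> f fi; exists (fmor G f); apply: fmor_iso. Qed.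

Lemma fobj_zero X : is_zero X -> is_zero (G X).
Proof. by move/zero_id0 => X0; apply: id0_zero; rewrite -fmor_id X0 fmor0. Qed.

Lemma fobj_biprod X Y S : biprod X Y S -> biprod (G X) (G Y) (G S).
Proof.
case=> i1 [i2 [p1 [p2 [h1 h2 h3 h4 h5]]]].
exists (fmor G i1), (fmor G i2), (fmor G p1), (fmor G p2).
by split; rewrite -!fmor_comp -?fmor_add ?h1 ?h2 ?h3 ?h4 ?h5 ?fmor_id ?fmor0.
Qed.

Lemma preim_subcat (D : F -> Prop) : is_subcat D -> is_subcat (fun X => D (G X)).
Proof.
case=> h1 h2 h3 h4; split.
- by move=> X Y /fmor_isomorphic; apply: h1.
- by move=> X /fobj_zero; apply: h2.
- by move=> X Y S /fobj_biprod; apply: h3.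
- by move=> X Y S /fobj_biprod; apply: h4.
Qed.

End AdditiveFunctors.

Section Adjunctions.
Local Open Scope ring_scope.
Context {k : fieldType} {E F : linCat k} {L : addFunctor E F}
  {R : addFunctor F E} (a : adjunction L R).

(** The inverse of the unit at [X] is the map that [L] sends to [counit a (L X)]. *)
Lemma unit_iso (X : E) : fully_faithful L -> is_iso (unit a X).
Proof.
move=> ff; have [inv K1 K2] := ff (R (L X)) X.
pose g := inv (counit a (L X)).
have eg : fmor L g = counit a (L X) by apply: K2.
exists g; split.
  have [inv' K1' _] := ff X X; apply: (can_inj K1').
  by rewrite fmor_comp eg counit_unit fmor_id.
by rewrite unit_nat eg unit_counit.
Qed.

Lemma counit_iso (Y : F) : fully_faithful R -> is_iso (counit a Y).
Proof.
move=> ff; have [inv K1 K2] := ff Y (L (R Y)).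
pose g := inv (unit a (R Y)).
have eg : fmor R g = unit a (R Y) by apply: K2.
exists g; split.
  by rewrite -counit_nat eg counit_unit.
have [inv' K1' _] := ff Y Y; apply: (can_inj K1').
by rewrite fmor_comp eg unit_counit fmor_id.
Qed.

Lemma isomorphic_unit (X : E) : fully_faithful L -> isomorphic X (R (L X)).
Proof. by move=> ff; exists (unit a X); apply: unit_iso. Qed.

Lemma isomorphic_counit (Y : F) : fully_faithful R -> isomorphic (L (R Y)) Y.
Proof. by move=> ff; exists (counit a Y); apply: counit_iso. Qed.

End Adjunctions.

Lemma exact_tri (k : fieldType) (E F : extriCat k) (G : addFunctor E F)
  (X Y Z : E) : exact_functor G -> tri X Y Z -> tri (G X) (G Y) (G Z).
Proof. by move=> ex [x [y t]]; exists (fmor G x), (fmor G y); apply: ex. Qed.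

Section ExactAdjunctions.
Local Open Scope ring_scope.
Context {k : fieldType} {E F : extriCat k} {L : addFunctor E F}
  {R : addFunctor F E} (a : adjunction L R).

(* The transpose of a lift of the unit along R(g) is a section of g. *)
Lemma adj_van_right (X : E) (Y : F) :
  exact_functor R -> van X (R Y) -> van (L X) Y.
Proof.
move=> Rex v d; have [M [y [g r]]] := realizes_ex (extri_realization F) d.
have [d' r'] := Rex _ _ _ _ _ (ex_intro _ d r).
have [s es] := hom_exact_right r' (v (pull (unit a X) d')).
apply: (realizes_section r (s := counit a M ∘ fmor L s)).
by rewrite comp_assoc -counit_nat -comp_assoc -fmor_comp -es counit_unit.
Qed.

(** Dually, the transpose of an extension of the counit along L(y) is a retraction of [y]. *)
Lemma adj_van_left (X : E) (Y : F) :
  exact_functor L -> van (L X) Y -> van X (R Y).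
Proof.
move=> Lex v d; have [M [y [g r]]] := realizes_ex (extri_realization E) d.
have [d' r'] := Lex _ _ _ _ _ (ex_intro _ d r).
have [s es] := cohom_exact_right r' (v (push (counit a Y) d')).
apply: (realizes_retraction r (s := fmor R s ∘ unit a M)).
by rewrite -comp_assoc unit_nat comp_assoc -fmor_comp -es unit_counit.
Qed.

Lemma adj_projective (P : E) :
  exact_functor R -> projective P -> projective (L P).
Proof.
by move=> Rex /projectiveP pP; apply/projectiveP => Y; apply: adj_van_right.
Qed.

Lemma adj_injective (I : F) :
  exact_functor L -> injective_obj I -> injective_obj (R I).
Proof.
by move=> Lex /injectiveP iI; apply/injectiveP => Y; apply: adj_van_left.
Qed.

Lemma adj_syzygy i (X Z : E) : exact_functor L -> exact_functor R ->
  syzygy i X Z -> syzygy i (L X) (L Z).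
Proof.
move=> Lex Rex; elim: i Z => [|i IH] Z; first by move=> /= ->.
move=> /syzygyS[W /IH XW [P pP t]]; apply/syzygyS; exists (L W) => //.
by exists (L P); [apply: adj_projective | apply: exact_tri].
Qed.

(** Exactness of [R] makes [L] preserve projectives, so the exact functor [L] carries syzygies to
    syzygies and the first-degree statements apply to them. *)
Lemma adj_ext_vanish i (X : E) (Y : F) :
  enough_projectives E -> enough_injectives E -> enough_injectives F ->
  exact_functor L -> exact_functor R ->
  ext_vanish i.+1 (L X) Y <-> ext_vanish i.+1 X (R Y).
Proof.
move=> eP eI eI' Lex Rex; have [Z XZ] := syzygy_ex i X eP.
rewrite -(ext_vanish_syz eI _ XZ).
rewrite -(ext_vanish_syz eI' _ (adj_syzygy Lex Rex XZ)).
by split; [apply: adj_van_left | apply: adj_van_right].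
Qed.

End ExactAdjunctions.

(** * Recollements: exactness of j_*, enough projectives and injectives *)

Section Recollement.
Local Open Scope ring_scope.
Context {k : fieldType} {A B C : extriCat k} (R : recollement A B C).
Hypothesis i_sh_exact : exact_functor (i_sh R).
Hypothesis j_sh_exact : exact_functor (j_sh R).

Lemma j_us_i_ls X : is_zero (j_us R (i_ls R X)).
Proof.
by apply/im_i_ker_j; exists X, (idm _); apply: is_iso_id.
Qed.

(** The counit i_*i^!j_*Z → j_*Z is zero by the adjunction of j^* and j_*, because j^*i_* = 0; a
    triangle identity then makes the identity of i^!j_*Z zero. *)
Lemma i_sh_j_ls Z : is_zero (i_sh R (j_ls R Z)).
Proof.
apply: id0_zero; rewrite -(unit_counit (adj_i_sh R)).
set c := counit _ _; have -> : c = 0; last by rewrite fmor0 comp0l.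
rewrite -[c]comp_idl -(unit_counit (adj_j_ls R) Z) -comp_assoc unit_nat.
by rewrite ((j_us_i_ls _).1 _ (fmor (j_us R) c)) fmor0 comp0l comp0r.
Qed.

(** The exact functor i^! sends the counit to an isomorphism, so i^!K = 0. With i^!j_* = 0, the
    second triangle of [rec_left] gives A0 = 0, hence K → j_*j^*X is invertible. *)
Lemma rec_left_triangle X :
  Etriangle (counit (adj_i_sh R) X) (unit (adj_j_ls R) X).
Proof.
have [A0 [h [K [g1 [g2 [t1 t2 -> _]]]]]] := rec_left R X.
have ci : is_iso (fmor (i_sh R) (counit (adj_i_sh R) X)).
  apply: retraction_iso (unit_counit (adj_i_sh R) X).
  exact: unit_iso (i_ls_ff R).
have [d1 r1] := i_sh_exact t1.
have K0 : is_zero (i_sh R K) by apply: realizes_iso_zero_right r1 ci.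
have [d2 r2] := i_sh_exact t2.
have A00 : is_zero A0.
  apply: isomorphic_zero (isomorphic_sym _) _.
    exact: isomorphic_unit (adj_i_sh R) _ (i_ls_ff R).
  exact: tri_zero_zero K0 (i_sh_j_ls _) (realizes_tri r2).
apply: (Etriangle_iso_right t1); have [d3 r3] := t2.
exact: realizes_zero_right r3 (fobj_zero _ A00).
Qed.

Lemma rec_left_tri X : tri (i_ls R (i_sh R X)) X (j_ls R (j_us R X)).
Proof. by do 2 eexists; apply: rec_left_triangle. Qed.

(* The cone K of j_* f satisfies i^!K = 0, hence K = j_*j^*K with j^*K the cone
   of f. *)
Lemma j_ls_exact : exact_functor (j_ls R).
Proof.
move=> X Y Z f g t; have [d r] := t.
have [|K [h1 [h2 [t1 _ _ e]]]] := (j_ls_lexact R).2 _ _ _ f g.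
  (* A triangle is left exact: its second map factors as itself followed by an identity, an
     inflation with zero cone. *)
  exists Z, g, (idm Z); split; rewrite ?comp_idl //; last by move=> *; apply: is_iso_id.
  have [O O0] := @ex_zero k C; exists O, 0, 0; exact: realizes_idl.
have [d1 r1] := t1.
have K0 : is_zero (i_sh R K).
  by apply: tri_zero_zero (exact_tri i_sh_exact (realizes_tri r1)); apply: i_sh_j_ls.
have ui : is_iso (unit (adj_j_ls R) K).
  have [d' r'] := rec_left_triangle K.
  exact: realizes_zero_left r' (fobj_zero _ K0).
have [d2 r2] := j_us_exact R t1.
have cX := counit_iso (adj_j_ls R) X (j_ls_ff R).
have cY := counit_iso (adj_j_ls R) Y (j_ls_ff R).
have cf := counit_nat (adj_j_ls R) f.
have [c [ec ecd]] := extri_ET3 r2 r cf.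
have ci : is_iso c by apply: five_right r2 r cf ec ecd cX cY.
(* By naturality j_*g is [h1] followed by the isomorphisms K → j_*j^*K → j_*Z. *)
have -> : fmor (j_ls R) g = fmor (j_ls R) c ∘ unit (adj_j_ls R) K ∘ h1.
  rewrite -comp_assoc unit_nat comp_assoc -fmor_comp ec fmor_comp -comp_assoc.
  by rewrite unit_counit comp_idr.
apply: Etriangle_iso_right t1 _.
by apply: is_iso_comp ui; apply: fmor_iso.
Qed.

Hypotheses (eP : enough_projectives B) (eI : enough_injectives B).

(** Embed i_*X into an injective of [B] and apply i^!, which preserves injectives because i_* is
    exact; i^!i_*X is X again. The next two lemmas follow the same pattern. *)
Lemma enough_injectives_A : enough_injectives A.
Proof.
move=> X; have [I [Z [x [y [t iI]]]]] := eI (i_ls R X).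
have ti := Etriangle_iso_left (i_sh_exact t)
  (unit_iso (adj_i_sh R) X (i_ls_ff R)).
exists (i_sh R I), (i_sh R Z); do 2 eexists; split; first exact: ti.
exact (adj_injective (adj_i_sh R) (i_ls_exact R) iI).
Qed.

Lemma enough_injectives_C : enough_injectives C.
Proof.
move=> X; have [I [Z [x [y [t iI]]]]] := eI (j_sh R X).
have ti := Etriangle_iso_left (j_us_exact R t)
  (unit_iso (adj_j_sh R) X (j_sh_ff R)).
exists (j_us R I), (j_us R Z); do 2 eexists; split; first exact: ti.
exact (adj_injective (adj_j_sh R) j_sh_exact iI).
Qed.

Lemma enough_projectives_C : enough_projectives C.
Proof.
move=> X; have [Z [P [x [y [t pP]]]]] := eP (j_ls R X).
have ti := Etriangle_iso_right (j_us_exact R t)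
  (counit_iso (adj_j_ls R) X (j_ls_ff R)).
exists (j_us R Z), (j_us R P); do 2 eexists; split; first exact: ti.
exact (adj_projective (adj_j_ls R) j_ls_exact pP).
Qed.

(** Here i^* is only right exact. It still sends P → i_*X to a deflation onto i^*i_*X, but the
    triangle starts at some K in place of i^*Z. *)
Lemma enough_projectives_A : enough_projectives A.
Proof.
move=> X; have [Z [P [x [y [t pP]]]]] := eP (i_ls R X).
have [|K [h1 [h2 [t1 _ _ _]]]] := (i_us_rexact R).2 _ _ _ x y.
  exists Z, (idm Z), x; split; rewrite ?comp_idr //; last by move=> *; apply: is_iso_id.
  have [O O0] := @ex_zero k B; exists O, 0, 0; exact: realizes_idr.
have ti := Etriangle_iso_right t1
  (counit_iso (adj_i_us R) X (i_ls_ff R)).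
exists K, (i_us R P); do 2 eexists; split; first exact: ti.
exact (adj_projective (adj_i_us R) (i_ls_exact R) pP).
Qed.

(** * The glued cotorsion pair *)

Section Gluing.
Context {U1 V1 : A -> Prop} {U3 V3 : C -> Prop}.
Hypotheses (c1 : cotorsion_pair U1 V1) (c3 : cotorsion_pair U3 V3).

Let V2 := glued_V R V1 V3.
Let U2 := glued_U R V1 V3.

Lemma glued_V_subcat : is_subcat V2.
Proof.
have [a1 a2 a3 a4] := preim_subcat (i_sh R) (cotorsion_subcatr c1).
have [b1 b2 b3 b4] := preim_subcat (j_us R) (cotorsion_subcatr c3).
split.
- by move=> X Y i [/(a1 _ _ i) u /(b1 _ _ i)].
- by move=> X X0; split; [apply: a2 | apply: b2].
- by move=> X Y S b [u w] [u' w']; split; [apply: a3 b u u' | apply: b3 b w w'].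
- by move=> X Y S b [/(a4 _ _ _ b)[u u'] /(b4 _ _ _ b)[w w']].
Qed.

Lemma glued_V_closed X Y Z : tri X Y Z -> V2 X -> V2 Z -> V2 Y.
Proof.
move=> t [vX wX] [vZ wZ]; split.
  exact: cotorsion_closedr c1 (exact_tri i_sh_exact t) vX vZ.
exact: cotorsion_closedr c3 (exact_tri (j_us_exact R) t) wX wZ.
Qed.

Lemma glued_V_i X : V1 X -> V2 (i_ls R X).
Proof.
move=> vX; have [h1 _ _ _] := cotorsion_subcatr c1.
have [_ h2 _ _] := cotorsion_subcatr c3; split; last exact/h2/j_us_i_ls.
exact: h1 (isomorphic_unit (adj_i_sh R) X (i_ls_ff R)) vX.
Qed.

Lemma glued_V_j Z : V3 Z -> V2 (j_ls R Z).
Proof.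
move=> vZ; have [_ h1 _ _] := cotorsion_subcatr c1.
have [h2 _ _ _] := cotorsion_subcatr c3; split; first exact/h1/i_sh_j_ls.
apply: h2 (isomorphic_sym _) vZ.
exact: isomorphic_counit (adj_j_ls R) Z (j_ls_ff R).
Qed.

Lemma glued_U_i X : U1 X -> U2 (i_ls R X).
Proof.
move=> uX Y [vY _]; apply: (adj_van_right (adj_i_sh R) i_sh_exact) => d.
exact: (cotorsion_ext c1).
Qed.

Lemma glued_U_j Z : U3 Z -> U2 (j_sh R Z).
Proof.
move=> uZ Y [_ vY]; apply: (adj_van_right (adj_j_sh R) (j_us_exact R)) => d.
exact: (cotorsion_ext c3).
Qed.

Lemma glued_U_closed X Y Z : tri X Y Z -> U2 X -> U2 Z -> U2 Y.
Proof. by move=> t uX uZ W vW; apply: van_cotri t; [apply: uX | apply: uZ]. Qed.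

Lemma glued_envelope X : exists V U, [/\ tri X V U, V2 V & U2 U].
Proof.
have [A' [h [K [g1 [g2 [t1 t2 _ _]]]]]] := rec_right R X.
have tK : tri (i_ls R A') (j_sh R (j_us R X)) K by exists h, g1.
have tX : tri K X (i_ls R (i_us R X)) by exists g2, (unit (adj_i_us R) X).
have [V [U [x [y [t vV uU]]]]] := cotorsion_envelope c3 (j_us R X).
have tj : tri (j_sh R (j_us R X)) (j_sh R V) (j_sh R U).
  by apply: exact_tri j_sh_exact _; exists x, y.
(* G is the cone of i_*A' → j_!V, so j^*G is j^*j_!V, that is V up to isomorphism. *)
have [G [tG tKG]] := tri_ET4 tK tj.
(* Gluing X and G along K gives X → Y with cone j_!U in the left class, while j^*Y remains V. *)
have [Y [tGY tXY]] := tri_common_start tKG tX.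
have VY : isomorphic V (j_us R Y).
  have VG := isomorphic_unit (adj_j_sh R) V (j_sh_ff R).
  apply: isomorphic_trans VG _.
  apply: (isomorphic_trans (tri_zero_left (j_us_i_ls A')
    (exact_tri (j_us_exact R) tG))).
  exact: tri_zero_right (j_us_i_ls _) (exact_tri (j_us_exact R) tGY).
have vY : V3 (j_us R Y) by have [h3 _ _ _] := cotorsion_subcatr c3; apply: h3 VY vV.
have [V' [U' [x' [y' [t' vV' uU']]]]] := cotorsion_envelope c1 (i_sh R Y).
have ti : tri (i_ls R (i_sh R Y)) (i_ls R V') (i_ls R U').
  by apply: exact_tri (i_ls_exact R) _; exists x', y'.
(* This replaces i_*i^!Y inside Y by i_*V': W is an extension of j_*j^*Y by i_*V', both in the right
   class. *)
have [W [tVW tYW]] := tri_common_start ti (rec_left_tri Y).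
(* The cone H of the composite X → Y → W is an extension of i_*U' by j_!U. *)
have [H [tXW tH]] := tri_ET4 tXY tYW.
exists W, H; split=> //.
  by apply: glued_V_closed tVW _ _; [apply: glued_V_i | apply: glued_V_j].
by apply: glued_U_closed tH _ _; [apply: glued_U_j | apply: glued_U_i].
Qed.

Lemma glued_cotorsion_pair : cotorsion_pair U2 V2.
Proof.
split.
- exact: left_perp1_subcat.
- exact: glued_V_subcat.
- by move=> X Y uX vY; apply: uX.
(* Salce's argument: an envelope O → V → U of a syzygy O of X gives triangles P → M → U and V → M →
   X, the second being the cover. *)
- move=> X; have [O [P [x [y [t /projectiveP pP]]]]] := eP X.
  have tX : tri O P X by exists x, y.
  have [V [U [tO vV uU]]] := glued_envelope O.
  have [M [tM [x' [y' t']]]] := tri_common_start tX tO.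
  exists V, M, x', y'; split=> //.
  by apply: glued_U_closed tM _ uU => Y _; apply: pP.
- move=> X; have [V [U [[x [y t]] vV uU]]] := glued_envelope X.
  by exists V, U, x, y.
Qed.

(** As j_* is exact and maps [V3] into the glued right class, E(j^*X, Y) = 0 follows from E(X, j_*Y)
    = 0. This makes the tilting bound of [C] applicable to j^*X. *)
Lemma glued_U_j_us X : U2 X -> U3 (j_us R X).
Proof.
move=> uX; apply: cotorsion_meml c3 _ => Y vY.
by apply: (adj_van_right (adj_j_ls R) j_ls_exact); apply/uX/glued_V_j.
Qed.

End Gluing.

(** * Transport of heredity and of the vanishing bounds *)

Let ePA := enough_projectives_A.
Let eIA := enough_injectives_A.
Let ePC := enough_projectives_C.
Let eIC := enough_injectives_C.

(** The glued right class is defined through the exact functors i^! and j^*, so it inherits closure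
    under cones from [A] and [C]. *)
Lemma glued_hereditary U1 V1 U3 V3 :
  hereditary_cotorsion_pair U1 V1 -> hereditary_cotorsion_pair U3 V3 ->
  hereditary_cotorsion_pair (glued_U R V1 V3) (glued_V R V1 V3).
Proof.
move=> h1 h3; apply: (cone_closed_hereditary eP eI).
  exact: glued_cotorsion_pair h1.1 h3.1.
move=> X Y Z t [vX wX] [vY wY]; split.
  exact: (hereditary_cone ePA eIA h1 (exact_tri i_sh_exact t) vX vY).
exact: (hereditary_cone ePC eIC h3 (exact_tri (j_us_exact R) t) wX wY).
Qed.

Lemma ext_vanish_i_ls i X Y : ext_vanish i.+1 X (i_sh R Y) ->
  ext_vanish i.+1 (i_ls R X) Y.
Proof.
by move/(adj_ext_vanish (adj_i_sh R) i X Y ePA eIA eI (i_ls_exact R) i_sh_exact).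
Qed.

Lemma ext_vanish_j_sh i Z Y : ext_vanish i.+1 Z (j_us R Y) ->
  ext_vanish i.+1 (j_sh R Z) Y.
Proof.
by move/(adj_ext_vanish (adj_j_sh R) i Z Y ePC eIC eI j_sh_exact (j_us_exact R)).
Qed.

Lemma ext_vanish_j_ls i X Z : ext_vanish i.+1 (j_us R X) Z ->
  ext_vanish i.+1 X (j_ls R Z).
Proof.
by move/(adj_ext_vanish (adj_j_ls R) i X Z eP eI eIC (j_us_exact R) j_ls_exact).
Qed.

Lemma ext_vanish_zero i (X Z : C) : is_zero Z -> ext_vanish i X Z.
Proof. by move=> Z0 W _; apply: van_zeror. Qed.

(** Both triangles of [rec_right] are used. A' is only known to exist, so the first hypothesis
    ranges over all of [A]; it sits one degree lower because K is the cone of i_*A' → j_!j^*X. *)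
Lemma ext_vanish_rec_right i X Y :
  (forall W, ext_vanish i.+1 (i_ls R W) Y) ->
  ext_vanish i.+2 (i_ls R (i_us R X)) Y ->
  ext_vanish i.+2 (j_sh R (j_us R X)) Y -> ext_vanish i.+2 X Y.
Proof.
move=> vi vu vj; have [A' [h [K [g1 [g2 [t1 t2 _ _]]]]]] := rec_right R X.
have tK : tri (i_ls R A') (j_sh R (j_us R X)) K by exists h, g1.
have tX : tri K X (i_ls R (i_us R X)) by exists g2, (unit (adj_i_us R) X).
apply: (ext_vanish_cotri_mid eP eI tX) => //.
by apply: (ext_vanish_cotri_right eP eI tK).
Qed.

Lemma glued_cotilting U1 V1 U3 V3 :
  cotilting_cotorsion_pair U1 V1 -> cotilting_cotorsion_pair U3 V3 ->
  cotilting_cotorsion_pair (glued_U R V1 V3) (glued_V R V1 V3).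
Proof.
move=> t1 t3; have [h1 _ _ _] := t1; have [h3 _ _ _] := t3.
have [n1 v1] := cotilting_vanish ePA eIA t1.
have [n3 v3] := cotilting_vanish ePC eIC t3.
have iso1 Y : V1 Y -> V1 (i_sh R (i_ls R Y)).
  have [_ [h _ _ _] _ _ _] := h1.1; apply: h.
  exact: isomorphic_unit (adj_i_sh R) Y (i_ls_ff R).
(* The successor on n1 pays for the term i_*A', met one degree lower. *)
apply: (vanish_cotilting eP eI (n := maxn n1.+1 n3)).
  exact: glued_hereditary h1 h3.
move=> X Y [vY wY] m; rewrite geq_max => /andP[m1 m3].
apply: (ext_vanish_tri_mid eP eI (rec_left_tri Y)); last first.
  by apply: ext_vanish_j_ls; apply: v3.
case: m m1 {m3} => // m; rewrite ltnS => m1.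
apply: ext_vanish_rec_right => [W||].
- by apply: ext_vanish_i_ls; apply: v1 => //; apply: iso1.
- by apply: ext_vanish_i_ls; apply: v1 (leqW m1); apply: iso1.
(* After adjunction the second argument is j^*i_*i^!Y, which is zero. *)
- by apply: ext_vanish_j_sh; apply/ext_vanish_zero/j_us_i_ls.
Qed.

Lemma glued_tilting U1 V1 U3 V3 :
  tilting_cotorsion_pair U1 V1 -> tilting_cotorsion_pair U3 V3 ->
  finite_projective_global_dim A ->
  tilting_cotorsion_pair (glued_U R V1 V3) (glued_V R V1 V3).
Proof.
move=> t1 t3 [n gl]; have [h1 _ _ _] := t1; have [h3 _ _ _] := t3.
have [n3 v3] := tilting_vanish ePC eIC t3.
(* By adjunction this is E^{m+1}(X, i^!Y), and X has a projective resolution of length n. *)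
have gA m X Y : (n <= m)%N -> ext_vanish m.+1 (i_ls R X) Y.
  move=> nm; apply: ext_vanish_i_ls.
  exact: (wedge_projective_vanish ePA eIA (gl X)).
apply: (vanish_tilting eP eI (n := maxn n.+1 n3)).
  exact: glued_hereditary h1 h3.
move=> X Y uX m; rewrite geq_max => /andP[m1 m3].
case: m m1 m3 => // m; rewrite ltnS => m1 m3.
apply: ext_vanish_rec_right => [W||]; try exact: gA.
  exact/gA/leqW.
apply: ext_vanish_j_sh; apply: v3 m3.
exact: glued_U_j_us h1.1 h3.1 _ uX.
Qed.

End Recollement.

Theorem theorem1p3 (k : fieldType) (A B C : extriCat k)
    (ksA : krull_schmidt A) (ksB : krull_schmidt B) (ksC : krull_schmidt C)
    (wicA : WIC A) (wicB : WIC B) (wicC : WIC C)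
    (R : recollement A B C)
    (projB : enough_projectives B) (injB : enough_injectives B)
    (i_sh_exact : exact_functor (i_sh R)) (j_sh_exact : exact_functor (j_sh R)) :
  (forall (U1 V1 : A -> Prop) (U3 V3 : C -> Prop),
     cotilting_cotorsion_pair U1 V1 -> cotilting_cotorsion_pair U3 V3 ->
     cotilting_cotorsion_pair (glued_U R V1 V3) (glued_V R V1 V3)) /\
  (forall (U1 V1 : A -> Prop) (U3 V3 : C -> Prop),
     tilting_cotorsion_pair U1 V1 -> tilting_cotorsion_pair U3 V3 ->
     finite_projective_global_dim A ->
     tilting_cotorsion_pair (glued_U R V1 V3) (glued_V R V1 V3)).
Proof.
split=> U1 V1 U3 V3; first exact: glued_cotilting.
exact: glued_tilting.
Qed.
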